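(* For any sequence of operations on two-parent hollow heaps (as defined and implemented in the context), starting with no heaps, the amortized time per operation is $O(1)$ for each operation other than delete and delete-min, and $O(\log N)$ for each delete or delete-min on a heap of $N$ nodes (full and hollow).
   Context: Heaps. A heap stores a finite set of items, each with a key from a totally ordered universe, and supports: make-heap() (return an empty heap); find-min($h$) (return an item of minimum key in $h$, or null if $h$ is empty); insert($e,k,h$) (add item $e$, which is in no heap, with key $k$); delete-min($h$) (delete from non-empty $h$ the item that find-min($h$) returns); meld($h_1,h_2$) (return a heap containing all items of the item-disjoint heaps $h_1,h_2$); decrease-key($e,k,h$) (given an item $e$ in $h$ with key greater than $k$, change its key to $k$); delete($e,h$) (delete item $e$ from $h$). Heaps passed as arguments are destroyed; decrease-key and delete are given the location of $e$. Nodes. Nodes hold items: each node holds at most one item, and is full if it holds one and hollow otherwise; each item in a heap is held by exactly one node; a newly created node is full and a hollow node never becomes full again. Each node $u$ has a key $u.key$ (the current key of its item if $u$ is full; if $u$ is hollow, the key its item had just before leaving $u$) and a non-negative integer rank $u.rank$. A tree (or dag) of nodes with arcs from parent to child is heap-ordered if $v.key\le w.key$ for every arc $(v,w)$; a root is a node with no parent. For two full roots, link makes the one of larger key (ties broken arbitrarily) a child of the other; the new child is the loser and the other the winner. A ranked link is a link of two roots of equal rank and increases the winner's rank by one; an unranked link may be applied to any two full roots and changes no ranks. Two-parent hollow heap. It is either empty or a heap-ordered directed acyclic graph of nodes with one root, which is full; the root is the minimum node. make-heap returns an empty heap; find-min returns the item in the root; meld returns one heap if the other is empty, and otherwise does an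 unranked link of the two roots; insert($e,k,h$) creates a new full node of rank 0 holding $e$ with key $k$ and melds this one-node heap with $h$. decrease-key($e,k,h$), with $u$ the node holding $e$: if $u$ is the root one may simply set $u.key=k$; otherwise create a new node $v$, move $e$ from $u$ to $v$ (so $u$ becomes hollow), set $v.key=k$ and $v.rank=\max\{0,u.rank-2\}$, add the arc $(v,u)$ so that $u$ acquires $v$ as an additional parent (no children of $u$ are moved), and meld the one-node heap $v$ with the heap. delete($e,h$) removes $e$ from the node $u$ holding it, making $u$ hollow; if $u$ is not the root this completes the operation; otherwise, while some root is hollow, destroy such a root (removing its outgoing arcs, so that children left with no parent become roots); then do ranked links while two roots have equal rank; then do unranked links until one root remains. delete-min($h$) performs delete on the item in the root. Implementation. The children of each node are kept in an exogenous singly-linked list; a link (and the arc added by decrease-key) makes the new child the first child of its parent; each node carries a bit recording whether it has two parents; when a node is destroyed, each of its children whose bit is false becomes a root and each child whose bit is true has it reset to false. During delete, roots of equal rank to be linked are found using an array of roots indexed by rank. *)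

(* Defs.v *)
From mathcomp Require Import all_boot all_order finmap.

Set Implicit Arguments.
Unset Strict Implicit.
Unset Printing Implicit Defensive.

Import Order.Theory.

Local Open Scope fset_scope.
Local Open Scope fmap_scope.

(** Two-parent hollow heaps are modelled as a small-step machine.  A transition
    reads and writes a bounded number of fields of nodes, list cells, array
    entries and heap pointers, and makes at most one key comparison; the time
    taken by an execution is the number of its transitions.  The algorithm's
    free choices (addresses of new nodes, ties, order in which roots are
    treated) are left nondeterministic. *)

(** Addresses of nodes and names of heaps. *)
Notation addr := nat (only parsing).
Notation heap := nat (only parsing).

Section TwoParentHollowHeaps.

Context {disp : Order.disp_t} {K : orderType disp} {E : Type}.

(** [item] is [None] when the node is hollow. *)
Record node := Node {
  key : K;
  item : option E;
  rank : nat;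
  children : seq addr;
  two_parents : bool }.

Definition set_key k n :=
  Node k (item n) (rank n) (children n) (two_parents n).
Definition make_hollow n :=
  Node (key n) None (rank n) (children n) (two_parents n).
Definition incr_rank n :=
  Node (key n) (item n) (rank n).+1 (children n) (two_parents n).
Definition set_children cs n :=
  Node (key n) (item n) (rank n) cs (two_parents n).
Definition set_two_parents b n :=
  Node (key n) (item n) (rank n) (children n) b.

Definition hollow n : bool := ~~ isSome (item n).

Definition memory := {fmap addr -> node}.

Definition update (u : addr) (f : node -> node) (m : memory) : memory :=
  if m.[? u] is Some n then m.[u <- f n] else m.

Definition has_arc (m : memory) (u v : addr) : bool :=
  if m.[? u] is Some n then v \in children n else false.

(** The nodes, full and hollow, of the dag rooted at [r]. *)
Definition dag_nodes (m : memory) (r : option addr) : {fset addr} :=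
  if obind (fun u => insub u : option (domf m)) r is Some x then
    [fset val y | y in connect (fun a b : domf m => has_arc m (val a) (val b)) x]
  else fset0.

Definition key_le (m : memory) (u v : addr) : bool :=
  match m.[? u], m.[? v] with
  | Some a, Some b => (key a <= key b)%O
  | _, _ => false
  end.

Definition add_child (u v : addr) (m : memory) : memory :=
  update u (fun n => set_children (v :: children n) n) m.

(** [link m u v w m']: linking [u] and [v] makes [w] the winner and turns [m]
    into [m'].  Both constructors apply when the keys are equal. *)
Inductive link (m : memory) (u v : addr) : addr -> memory -> Prop :=
| link_left : key_le m u v -> link m u v u (add_child u v m)
| link_right : key_le m v u -> link m u v v (add_child v u m).

(** [DecreaseKey e u k h] and [Delete e u h] are given the node [u] that holds
    [e]. *)
Inductive operation :=
| MakeHeap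
| FindMin of heap
| Insert of E & K & heap
| DeleteMin of heap
| Meld of heap & heap
| DecreaseKey of E & addr & K & heap
| Delete of E & addr & heap.

Inductive control :=
| Idle
| Answer of option E
  (* find-min is about to return this item *)
| Return of option addr
  (* the operation is about to return the heap with this root *)
| Melding of option addr & option addr
| Choosing of seq addr & seq addr
  (* delete: hollow roots, full roots *)
| Destroying of addr & seq addr & seq addr
  (* delete: root being destroyed, other hollow roots, full roots *)
| Placing of seq addr & nat
  (* delete: roots to be put in the array, largest rank used in the array *)
| Ranking of addr & seq addr & nat
  (* delete: root being put in the array, then as for [Placing] *)
| Scanning of nat & nat & seq addr
  (* delete: next and last array index to visit, roots found so far *)
| Uniting of seq addr.
  (* delete: roots to be combined by unranked links *)

(** [array] is the array of roots indexed by rank.  It is shared by all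
    deletes, which have to leave it empty. *)
Record state := State {
  store : memory;
  heaps : {fmap heap -> option addr};
  array : {fmap nat -> addr};
  ctl : control }.

Implicit Types (m : memory) (H : {fmap heap -> option addr})
  (A : {fmap nat -> addr}) (h : heap) (u v w l : addr) (r : option addr)
  (hs fs cs rs : seq addr) (e : E) (k : K).

Definition heap_nodes m H h : {fset addr} := dag_nodes m (odflt None H.[? h]).

(** Node [u] of heap [h] holds item [e]. *)
Definition holds m H h u e : Prop :=
  u \in heap_nodes m H h /\ obind item m.[? u] = Some e.

Definition in_heap m H h e : Prop := exists u, holds m H h u e.

(** A transition labelled [Some o] is the invocation of [o]; the other
    transitions carry on with the operation in progress. *)
Inductive step : state -> option operation -> state -> Prop :=

| step_make_heap m H A :
    step (State m H A Idle) (Some MakeHeap) (State m H A (Return None))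

| step_find_min m H A h r :
    H.[? h] = Some r ->
    step (State m H A Idle) (Some (FindMin h))
         (State m H A (Answer (obind (fun u => obind item m.[? u]) r)))

| step_insert m H A h r e k u :
    H.[? h] = Some r ->
    (forall h', ~ in_heap m H h' e) ->
    u \notin domf m ->
    step (State m H A Idle) (Some (Insert e k h))
         (State m.[u <- Node k (Some e) 0 [::] false] H.[~ h] A
                (Melding (Some u) r))

| step_meld m H A h1 h2 r1 r2 :
    h1 != h2 ->
    H.[? h1] = Some r1 ->
    H.[? h2] = Some r2 ->
    (forall e, in_heap m H h1 e -> ~ in_heap m H h2 e) ->
    step (State m H A Idle) (Some (Meld h1 h2))
         (State m H.[~ h1].[~ h2] A (Melding r1 r2))

(* At the root, setting the key is optional: alternatively the new node becomes
   the root and the only parent of the old one, with nothing left to link. *)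
| step_decrease_key_root m H A h u n e k :
    H.[? h] = Some (Some u) ->
    holds m H h u e ->
    m.[? u] = Some n ->
    (k < key n)%O ->
    step (State m H A Idle) (Some (DecreaseKey e u k h))
         (State (update u (set_key k) m) H.[~ h] A (Return (Some u)))

| step_decrease_key_new_root m H A h u n e k v :
    H.[? h] = Some (Some u) ->
    holds m H h u e ->
    m.[? u] = Some n ->
    (k < key n)%O ->
    v \notin domf m ->
    step (State m H A Idle) (Some (DecreaseKey e u k h))
         (State (update u make_hollow m)
                  .[v <- Node k (Some e) (rank n - 2) [:: u] false]
                H.[~ h] A (Return (Some v)))

| step_decrease_key m H A h w u n e k v :
    H.[? h] = Some (Some w) ->
    u != w ->
    holds m H h u e ->
    m.[? u] = Some n ->
    (k < key n)%O ->
    v \notin domf m ->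
    step (State m H A Idle) (Some (DecreaseKey e u k h))
         (State (update u (fun x => set_two_parents true (make_hollow x)) m)
                  .[v <- Node k (Some e) (rank n - 2) [:: u] false]
                H.[~ h] A (Melding (Some v) (Some w)))

| step_delete m H A h w u e :
    H.[? h] = Some (Some w) ->
    u != w ->
    holds m H h u e ->
    step (State m H A Idle) (Some (Delete e u h))
         (State (update u make_hollow m) H.[~ h] A (Return (Some w)))

| step_delete_root m H A h u e :
    H.[? h] = Some (Some u) ->
    holds m H h u e ->
    step (State m H A Idle) (Some (Delete e u h))
         (State (update u make_hollow m) H.[~ h] A (Choosing [:: u] [::]))

| step_delete_min m H A h u :
    H.[? h] = Some (Some u) ->
    step (State m H A Idle) (Some (DeleteMin h))
         (State (update u make_hollow m) H.[~ h] A (Choosing [:: u] [::]))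

| step_answer m H A x :
    step (State m H A (Answer x)) None (State m H A Idle)

| step_return m H A r h :
    h \notin domf H ->
    step (State m H A (Return r)) None (State m H.[h <- r] A Idle)

| step_meld_empty_l m H A r :
    step (State m H A (Melding None r)) None (State m H A (Return r))

| step_meld_empty_r m H A r :
    step (State m H A (Melding r None)) None (State m H A (Return r))

| step_meld_link m H A u v w m' :
    link m u v w m' ->
    step (State m H A (Melding (Some u) (Some v))) None
         (State m' H A (Return (Some w)))

| step_choose m H A hs fs u :
    u \in hs ->
    step (State m H A (Choosing hs fs)) None
         (State m H A (Destroying u (rem u hs) fs))

| step_destroy_second_parent m H A u hs fs n w cs x :
    m.[? u] = Some n ->
    children n = w :: cs ->
    m.[? w] = Some x ->
    two_parents x ->
    step (State m H A (Destroying u hs fs)) None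
         (State (update w (set_two_parents false) (update u (set_children cs) m))
                H A (Destroying u hs fs))

| step_destroy_last_parent m H A u hs fs n w cs x :
    m.[? u] = Some n ->
    children n = w :: cs ->
    m.[? w] = Some x ->
    ~~ two_parents x ->
    step (State m H A (Destroying u hs fs)) None
         (State (update u (set_children cs) m) H A
                (if hollow x then Destroying u (w :: hs) fs
                 else Destroying u hs (w :: fs)))

| step_destroy_end m H A u hs fs n :
    m.[? u] = Some n ->
    children n = [::] ->
    step (State m H A (Destroying u hs fs)) None
         (State m.[~ u] H A (Choosing hs fs))

| step_choose_end m H A fs :
    step (State m H A (Choosing [::] fs)) None (State m H A (Placing fs 0))

| step_place m H A fs b u :
    u \in fs ->
    step (State m H A (Placing fs b)) None
         (State m H A (Ranking u (rem u fs) b))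

| step_store m H A u fs b n :
    m.[? u] = Some n ->
    A.[? rank n] = None ->
    step (State m H A (Ranking u fs b)) None
         (State m H A.[rank n <- u] (Placing fs (maxn b (rank n))))

| step_ranked_link m H A u fs b n v w m' :
    m.[? u] = Some n ->
    A.[? rank n] = Some v ->
    link m u v w m' ->
    step (State m H A (Ranking u fs b)) None
         (State (update w incr_rank m') H A.[~ rank n] (Ranking w fs b))

| step_place_end m H A b :
    step (State m H A (Placing [::] b)) None
         (State m H A (Scanning 0 b [::]))

| step_scan_none m H A i b rs :
    i <= b ->
    A.[? i] = None ->
    step (State m H A (Scanning i b rs)) None
         (State m H A (Scanning i.+1 b rs))

| step_scan_some m H A i b rs u :
    i <= b ->
    A.[? i] = Some u ->
    step (State m H A (Scanning i b rs)) None
         (State m H A.[~ i] (Scanning i.+1 b (u :: rs)))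

| step_scan_end m H A i b rs :
    b < i ->
    step (State m H A (Scanning i b rs)) None (State m H A (Uniting rs))

| step_unranked_link m H A rs w l :
    w \in rs ->
    l \in rem w rs ->
    key_le m w l ->
    step (State m H A (Uniting rs)) None
         (State (add_child w l m) H A (Uniting (rem l rs)))

| step_unite_end m H A u :
    step (State m H A (Uniting [:: u])) None
         (State m H A (Return (Some u)))

| step_unite_none m H A :
    step (State m H A (Uniting [::])) None (State m H A (Return None)).

Definition initial_state : state := State [fmap] [fmap] [fmap] Idle.

(** [execution t tr s]: from the state with no heaps, the machine can reach [s]
    in time [t]; [tr] lists the operations invoked, each with the state in which
    it was invoked.  The last operation may be still in progress in [s], so that
    bounds on [t] also rule out operations that do not terminate. *)
Inductive execution : nat -> seq (operation * state) -> state -> Prop :=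
| execution_start : execution 0 [::] initial_state
| execution_invoke t tr s o s' :
    execution t tr s -> step s (Some o) s' ->
    execution t.+1 (rcons tr (o, s)) s'
| execution_continue t tr s s' :
    execution t tr s -> step s None s' ->
    execution t.+1 tr s'.

Definition num_nodes (s : state) (h : heap) : nat :=
  #|` heap_nodes (store s) (heaps s) h|.

(** [c] for an operation other than a delete, [d * (1 + floor (log2 N))] for a
    delete on a heap of [N] nodes; the [1 +] matters for [N = 1] only, up to the
    choice of [d]. *)
Definition amortized_time (c d : nat) (i : operation * state) : nat :=
  match i.1 with
  | DeleteMin h | Delete _ _ h => d * (trunc_log 2 (num_nodes i.2 h)).+1
  | _ => c
  end.

End TwoParentHollowHeaps.

Arguments node {disp} K E.
Arguments memory {disp} K E.
Arguments operation {disp} K E.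
Arguments state {disp} K E.

(* Main.v *)
Require Import Defs.
From mathcomp Require Import all_boot all_order finmap zify.

Set Implicit Arguments.
Unset Strict Implicit.
Unset Printing Implicit Defensive.

(** Charge each arc and each node that has no full virtual ranked parent.  The
    ranked children of a node in the dag are not those that matter: following
    the one-parent variant, where [decrease-key] moves all the children of low
    rank to the new node, the move is here only made in a virtual forest.  There
    a node of rank [r] has children of ranks [r-1] and [r-2], so its
    subtree, all of which it reaches in the dag, has at least [2^(r/2)] nodes,
    and ranks are logarithmic.  Emptying a node of rank [r] charges [r] more
    nodes if its item is deleted, but at most two if its item moves to a new
    node; destroying a hollow node charges none, and each ranked link frees a
    node and so pays for itself.  What remains of a delete is proportional to
    the largest possible rank. *)

(** A virtual child only has to be reachable from its virtual parent. Adding arcs preserves this,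
    and an arc is removed only when it leaves a parentless node, which no path from elsewhere
    crosses. Hence only the node being destroyed can lose reachable nodes, and it is detached from
    its virtual children before its first arc is cut. The rank bound of a delete must refer to the
    heap as it was at invocation, while its nodes disappear and its ranks grow. A set of nodes
    closed under arcs is therefore fixed once: links stay inside it, cuts keep it closed, and every
    virtual tree rooted in it fits in it. The list [bads] is only an upper bound for the charged
    nodes, possibly with repetitions. What matters is that a parentless node always occurs in it, so
    that destroying a root or losing a ranked link really releases potential. *)

Section Arcs.

Implicit Types (arcs : seq (nat * nat)) (S : pred nat) (u v w x y : nat).

(** * Reachability in a list of arcs *)

Definition parents arcs v := count_mem v (unzip2 arcs).

Definition closed arcs S := forall u v, (u, v) \in arcs -> S u -> S v.

(** Closed sets replace paths: monotonicity in the arcs and transitivity become immediate, and a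
    virtual subtree lies in every closed set that contains its root. *)
Definition reach arcs u v := forall S, closed arcs S -> S u -> S v.

Lemma parents_gt0 arcs u v : (u, v) \in arcs -> 0 < parents arcs v.
Proof.
move=> uv; rewrite -has_count has_pred1.
by apply/mapP; exists (u, v).
Qed.

Lemma parents_rem arcs u v w :
  (u, v) \in arcs -> parents (rem (u, v) arcs) w = parents arcs w - (v == w).
Proof.
move=> uv; have /(perm_map snd) := perm_to_rem uv.
by move=> /seq.permP /(_ (pred1 w)); rewrite /= /parents /unzip2 => ->; rewrite addKn.
Qed.

Lemma parents_cons arcs u v w :
  parents ((u, v) :: arcs) w = (v == w) + parents arcs w.
Proof. by []. Qed.

Lemma parentless_closed arcs v : parents arcs v = 0 -> closed arcs (predC1 v).
Proof.
move=> v0 x y xy _ /=; apply/eqP => yv.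
by move: (parents_gt0 xy); rewrite yv v0.
Qed.

Lemma sub_closed arcs arcs' S :
  {subset arcs <= arcs'} -> closed arcs' S -> closed arcs S.
Proof. by move=> sub cl u v /sub; apply: cl. Qed.

Lemma sub_reach arcs arcs' u v :
  {subset arcs <= arcs'} -> reach arcs u v -> reach arcs' u v.
Proof. by move=> sub uv S /(sub_closed sub); apply: uv. Qed.

Lemma reach_arc arcs u v : (u, v) \in arcs -> reach arcs u v.
Proof. by move=> uv S; apply. Qed.

Lemma reach_trans arcs u v w : reach arcs u v -> reach arcs v w -> reach arcs u w.
Proof. by move=> uv vw S cl /(uv S cl); apply: vw. Qed.

Lemma parentless_reach arcs u v : parents arcs v = 0 -> reach arcs u v -> u = v.
Proof.
move=> v0 uv; apply/eqP; apply: contraT => nuv.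
by have := uv _ (parentless_closed v0) nuv; rewrite /= eqxx.
Qed.

(** A path that starts away from the parentless [u] never enters it, so it uses no arc out of [u].
    Formally, [S] deprived of [u] is closed under all of [arcs]. *)
Lemma reach_rem arcs u v x y : parents arcs u = 0 -> x != u ->
  reach arcs x y -> reach (rem (u, v) arcs) x y.
Proof.
move=> u0 xu xy S cl Sx.
suff /andP[] : (y != u) && S y by [].
apply: (xy (fun z => (z != u) && S z)); last by rewrite xu.
move=> a b ab /andP[au Sa]; apply/andP; split.
  exact: (parentless_closed u0 ab).
apply: cl Sa; rewrite -has_pred1 has_count count_mem_rem xpair_eqE.
by rewrite (eq_sym u) (negPf au) subn0 -has_count has_pred1.
Qed.

End Arcs.

(** * The virtual forest *)

(** [vp] maps a node to its virtual ranked parent, and fixes the nodes that have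
    none.  When [decrease-key] moves the item of [u] to [v], the ranked children
    of [u] of rank less than [rk v] become virtual children of [v], although in
    the dag they remain children of [u]; hence a hollow node is only known to
    have children of its two largest possible ranks.  The nodes in [bads] carry
    potential.  The node [d] is being destroyed and has given up its virtual
    children. *)
Record virtual_forest (dom full : pred nat) (rk : nat -> nat)
    (arcs : seq (nat * nat)) (vp : nat -> nat) (bads : seq nat)
    (d : option nat) : Prop := VirtualForest {
  vf_reach w : vp w != w -> reach arcs (vp w) w;
  vf_dom w : vp w != w -> dom w;
  vf_rank w : vp w != w -> rk w < rk (vp w);
  vf_inj w w' : vp w != w -> vp w' != w' -> vp w = vp w' -> rk w = rk w' ->
    w = w';
  vf_children x i : dom x -> d != Some x -> i < rk x ->
    full x || (rk x <= i.+2) -> exists w, [/\ vp w = x, w != x & rk w = i];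
  vf_destroyed w : vp w != w -> d != Some (vp w);
  vf_bads x : dom x -> (vp x == x) || ~~ full (vp x) -> x \in bads }.

Section VirtualForest.

Variables (dom full : pred nat) (rk : nat -> nat) (arcs : seq (nat * nat)).
Variables (vp : nat -> nat) (bads : seq nat) (d : option nat).
Hypothesis vf : virtual_forest dom full rk arcs vp bads d.

Lemma vp_undef x : ~~ dom x -> vp x = x.
Proof. by apply: contraNeq => /(vf_dom vf). Qed.

Lemma vp_parentless x : parents arcs x = 0 -> vp x = x.
Proof.
move=> x0; apply/eqP/negPn/negP => vx; move: (vx).
by rewrite (parentless_reach x0 (vf_reach vf vx)) eqxx.
Qed.

Lemma parentless_bad x : dom x -> parents arcs x = 0 -> x \in bads.
Proof. by move=> dx /vp_parentless vx; apply: (vf_bads vf) => //; rewrite vx eqxx. Qed.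

(** Virtual siblings have distinct ranks, all below [rk u], so ranks inject the chosen children into
    an interval of length [rk u - a]. Deletion uses [a = 0], decrease-key [a = rk u - 2]. *)
Lemma virtual_children_seq u a (domain : seq nat) :
  (forall x, dom x = (x \in domain)) ->
  exists2 s : seq nat, size s <= rk u - a &
    forall x, vp x = u -> x != u -> a <= rk x -> x \in s.
Proof.
move=> domE.
exists [seq x <- undup domain | [&& vp x == u, x != u & a <= rk x]]; last first.
  move=> x vx xu ax; rewrite mem_filter vx xu ax eqxx mem_undup -domE.
  by rewrite (vf_dom vf) // vx eq_sym.
set s := filter _ _.
have sP x : x \in s -> [/\ vp x = u, vp x != x & a <= rk x].
  by rewrite mem_filter => /andP[/and3P[/eqP <- vx ->] _]; split=> //; rewrite eq_sym.
rewrite -(size_map rk) -(size_iota a (rk u - a)); apply: uniq_leq_size.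
  rewrite map_inj_in_uniq ?filter_uniq ?undup_uniq // => x y.
  move=> /sP[vx xv _] /sP[vy yv _]; apply: (vf_inj vf) => //.
  by rewrite vx vy.
move=> i /mapP[x /sP[vx xv ax] ->]; rewrite mem_iota ax.
by have := vf_rank vf xv; rewrite vx; lia.
Qed.

Lemma rank_iter_vp k x : rk x <= rk (iter k vp x).
Proof.
elim: k => //= k IH; have [->//|ne] := eqVneq (vp (iter k vp x)) (iter k vp x).
by rewrite (leq_trans IH) // ltnW // (vf_rank vf).
Qed.

(** Ranks never decrease along [vp]. From a common descendant, the chain would climb from one
    sibling through the parent [z] to the other sibling, whose rank is less than that of [z]. *)
Lemma virtual_siblings_disjoint x y z j k : vp x = z -> x != z ->
  vp y = z -> y != z -> rk x < rk y -> forall w, iter j vp w = x -> iter k vp w <> y.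
Proof.
move=> vx xz vy yz xy w wx wy.
have rx : rk x < rk z by rewrite -vx (vf_rank vf) // vx eq_sym.
have ry : rk y < rk z by rewrite -vy (vf_rank vf) // vy eq_sym.
have [jk|kj] := leqP j k.
  move: wy; rewrite -(subnK jk) iterD wx.
  case: (k - j) => [/= e|n]; first by move: xy; rewrite e ltnn.
  rewrite iterSr vx => e; have := rank_iter_vp n z; rewrite e; lia.
move: wx; rewrite -(subnK (ltnW kj)) iterD wy.
have : 0 < j - k by lia.
case: (j - k) => // n _; rewrite iterSr vy => e.
have := rank_iter_vp n z; rewrite e; lia.
Qed.

(** Full or hollow, [x] has virtual children of its two largest possible ranks. Their disjoint
    subtrees both have at least [2 ^ (rk x).-2./2] elements, so the bound doubles every two
    ranks. *)
Lemma virtual_tree_size (S : seq nat) x : d = None -> closed arcs (mem S) ->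
  dom x -> x \in S -> 2 ^ (rk x)./2 <= size S.
Proof.
move=> d0 clS dx xS.
(* The induction builds a duplicate-free list of virtual descendants, since disjointness of the two
   subtrees is proved from their chains to [x]. *)
suff [s [us sS]] : exists s, [/\ uniq s, {subset s <= S} &
    2 ^ (rk x)./2 <= size s /\ forall y, y \in s -> exists k, iter k vp y = x].
  by case=> /leq_trans le _; apply: le; apply: uniq_leq_size.
have [n] := ubnP (rk x); elim: n x dx xS => // n IH x dx xS rn.
have child i : i < rk x -> rk x <= i.+2 ->
    exists w, [/\ vp w = x, w != x & rk w = i] /\ dom w /\ w \in S.
  move=> ix xi; have [||||w [vw wx rw]] := vf_children vf (x := x) (i := i) => //.
  - by rewrite d0.
  - by rewrite xi orbT.
  exists w; split=> //; have vne : vp w != w by rewrite vw eq_sym.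
  split; first exact: (vf_dom vf).
  by apply: (vf_reach vf vne) clS _; rewrite vw.
have [r2|r2] := leqP (rk x) 1.
  exists [:: x]; split=> //; first by move=> y; rewrite inE => /eqP->.
  split; first by case: (rk x) r2 => [|[]].
  by move=> y; rewrite inE => /eqP ->; exists 0.
have half : (rk x)./2 = (rk x).-2./2.+1 by case: (rk x) r2 => [|[]].
have half_le : (rk x).-2./2 <= (rk x).-1./2 by apply: half_leq; lia.
have lt1 : (rk x).-1 < n by lia.
have lt2 : (rk x).-2 < (rk x).-1 by lia.
have [||a [[va ax ra] [da aS]]] := child (rk x).-1; [lia|lia|].
have [||b [[vb bx rb] [db bS]]] := child (rk x).-2; [lia|lia|].
have [|s [us sS [ns sP]]] := IH a da aS; first by rewrite ra.
have [|t [ut tS [nt tP]]] := IH b db bS; first by rewrite rb (ltn_trans lt2).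
exists (s ++ t); split.
- rewrite cat_uniq us ut andbT; apply/hasPn => y /tP[j yb].
  apply/negP => /sP[k ya]; move: ya.
  by apply: (virtual_siblings_disjoint vb bx va ax _ yb); rewrite ra rb.
- by move=> y; rewrite mem_cat => /orP[/sS|/tS].
split; last first.
  by move=> y; rewrite mem_cat => /orP[/sP|/tP] [k e]; exists k.+1; rewrite iterS e.
rewrite size_cat; apply: leq_trans (leq_add ns nt).
by rewrite ra rb half expnS mul2n -addnn leq_add2r leq_exp2l.
Qed.

(** * Effect of each elementary change on the virtual forest *)

Section Updates.

Variables (dom' full' : pred nat) (rk' : nat -> nat).

(** Paths from [d] are exempt, as [d] has no virtual child; this allows its arcs to be cut one at a
    time. *)
Lemma vf_same arcs' : dom' =1 dom -> full' =1 full -> rk' =1 rk ->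
  (forall x y, d != Some x -> reach arcs x y -> reach arcs' x y) ->
  virtual_forest dom' full' rk' arcs' vp bads d.
Proof.
move=> dE fE rE aE; split.
- by move=> w vw; apply: aE; [apply: (vf_destroyed vf) | apply: (vf_reach vf)].
- by move=> w; rewrite dE; apply: (vf_dom vf).
- by move=> w; rewrite !rE; apply: (vf_rank vf).
- by move=> w w'; rewrite !rE; apply: (vf_inj vf).
- move=> x i; rewrite dE fE rE => dx xd ix fx.
  have [w [vw wx rw]] := vf_children vf dx xd ix fx.
  by exists w; rewrite rE.
- exact: (vf_destroyed vf).
- by move=> x; rewrite dE fE; apply: (vf_bads vf).
Qed.

Lemma vf_new u : ~~ dom u -> rk u = 0 -> d = None ->
  (forall x, dom' x = (x == u) || dom x) ->
  (forall x, full' x = (x == u) || full x) ->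
  rk' =1 rk -> virtual_forest dom' full' rk' arcs vp (u :: bads) None.
Proof.
move=> du ru d0 dE fE rE; split.
- exact: (vf_reach vf).
- by move=> w vw; rewrite dE (vf_dom vf vw) orbT.
- by move=> w; rewrite !rE; apply: (vf_rank vf).
- by move=> w w'; rewrite !rE; apply: (vf_inj vf).
- move=> x i; rewrite dE fE rE; have [->|xu] := eqVneq x u; first by rewrite ru.
  move=> dx _ ix fx; have [|w [vw wx rw]] := vf_children vf dx _ ix fx.
    by rewrite d0.
  by exists w; rewrite rE.
- by [].
- move=> x; rewrite dE fE inE; have [//|xu] := eqVneq x u => dx bx.
  apply: (vf_bads vf) => //; move: bx; rewrite negb_or.
  by case/orP => [->//|/andP[_ ->]]; rewrite orbT.
Qed.

Lemma vf_delete u s : d = None -> dom' =1 dom -> rk' =1 rk ->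
  (forall x, full' x = (x != u) && full x) ->
  (forall x, vp x = u -> x != u -> x \in s) ->
  virtual_forest dom' full' rk' arcs vp (s ++ bads) None.
Proof.
move=> d0 dE rE fE sP; split.
- exact: (vf_reach vf).
- by move=> w; rewrite dE; apply: (vf_dom vf).
- by move=> w; rewrite !rE; apply: (vf_rank vf).
- by move=> w w'; rewrite !rE; apply: (vf_inj vf).
- move=> x i; rewrite dE fE rE => dx _ ix fx.
  have [||w [vw wx rw]] := vf_children vf dx _ ix; first by rewrite d0.
    by case/orP: fx => [/andP[_ ->]|->]; rewrite ?orbT.
  by exists w; rewrite rE.
- by [].
- move=> x; rewrite dE fE negb_and negbK mem_cat => dx bx.
  have [vx|vx] := eqVneq (vp x) x; first by rewrite (vf_bads vf) ?vx ?eqxx ?orbT.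
  case/or3P: bx => [|/eqP vu|fx]; first by rewrite (negPf vx).
    by rewrite sP // -vu eq_sym.
  by rewrite (vf_bads vf) ?fx ?orbT.
Qed.

(** The arc from [v] to [u] lets [v] reach all that [u] reaches, so [v] can adopt the children of
    rank less than [rk u - 2], which keep a full virtual parent. The others stay with the hollow [u]
    and turn bad. *)
Lemma vf_decrease_key u v s arcs' : d = None -> dom u -> full u -> ~~ dom v ->
  rk v = 0 -> full v = false ->
  (forall x, dom' x = (x == v) || dom x) ->
  (forall x, full' x = (x == v) || (x != u) && full x) ->
  (forall x, rk' x = if x == v then rk u - 2 else rk x) ->
  arcs' = (v, u) :: arcs ->
  (forall x, vp x = u -> x != u -> rk u - 2 <= rk x -> x \in s) ->
  exists vp', virtual_forest dom' full' rk' arcs' vp' (v :: s ++ bads) None.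
Proof.
move=> d0 du fu dv rv fv dE fE rE -> sP.
have uv : u != v by apply: contraNneq dv => <-.
have vpv : vp v = v by apply: vp_undef.
pose moved w := [&& vp w == u, w != u & rk w < rk u - 2].
exists (fun w => if moved w then v else vp w).
have domv w : dom w -> w != v by apply: contraTneq => ->.
have movedP w : moved w -> [/\ vp w = u, vp w != w, w != v & rk w < rk u - 2].
  case/and3P => /eqP e wu r; have ne : vp w != w by rewrite e eq_sym.
  by split=> //; apply: domv; apply: (vf_dom vf).
have vpv' w : vp w != w -> vp w != v.
  by move=> vw; apply: contraTneq (vf_rank vf vw) => ->; rewrite rv.
have sub : {subset arcs <= (v, u) :: arcs} by move=> a; rewrite inE orbC => ->.
split.
- move=> w; case: ifP => [mw|_] ne; last exact: sub_reach sub (vf_reach vf ne).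
  have [vw ne' _ _] := movedP w mw.
  apply: reach_trans (sub_reach sub (vf_reach vf ne')).
  by rewrite vw; apply: reach_arc; rewrite inE eqxx.
- move=> w; rewrite dE; case: ifP => [mw _|_ ne].
    by have [_ ne _ _] := movedP w mw; rewrite (vf_dom vf ne) orbT.
  by rewrite (vf_dom vf ne) orbT.
- move=> w; rewrite !rE; case: ifP => [mw _|_ ne].
    by have [_ _ wv r] := movedP w mw; rewrite eqxx (negPf wv).
  rewrite (negPf (vpv' w ne)) (negPf (domv _ (vf_dom vf ne))).
  exact: (vf_rank vf).
- move=> w w'; rewrite !rE; case: ifP => [mw|_]; case: ifP => [mw'|_] ne ne'.
  + have [e en ev _] := movedP w mw; have [e' en' ev' _] := movedP w' mw'.
    by rewrite (negPf ev) (negPf ev') => _; apply: (vf_inj vf) => //; rewrite e e'.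
  + by move=> e; have := vpv' _ ne'; rewrite -e eqxx.
  + by move=> e; have := vpv' _ ne; rewrite e eqxx.
  rewrite (negPf (domv _ (vf_dom vf ne))) (negPf (domv _ (vf_dom vf ne'))).
  exact: (vf_inj vf).
- move=> x i; rewrite dE fE rE; have [->|xv] := eqVneq x v; rewrite /= ?eqxx.
    move=> _ _ iu _; have [|||w [vw wu rw]] := vf_children vf du (i := i).
    * by rewrite d0.
    * lia.
    * by rewrite fu.
    have mw : moved w by rewrite /moved vw eqxx wu rw.
    exists w; rewrite mw rE; have [_ _ wv _] := movedP w mw.
    by rewrite (negPf wv).
  move=> dx _ ix fx; have [||w [vw wu rw]] := vf_children vf dx _ ix.
  * by rewrite d0.
  * by case/orP: fx => [/andP[_ ->]|->]; rewrite ?orbT.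
  exists w; rewrite rE (negPf (domv w _)); last by apply: (vf_dom vf); rewrite vw eq_sym.
  (* If [w] had moved, [x] would be the now hollow [u], which owes no child of rank below
     [rk u - 2]. *)
  rewrite ifF //; apply/negP => /movedP[vwu _ _ lt].
  by move: fx; rewrite -{1}vw vwu eqxx /=; rewrite -vw vwu; lia.
- by [].
- move=> x; rewrite dE inE mem_cat; have [//|xv] /= := eqVneq x v => dx.
  case: ifP => [mx|nm].
    by rewrite fE eqxx orbF eq_sym (negPf xv).
  have [vx _|vx /=] := eqVneq (vp x) x.
    by rewrite (vf_bads vf) ?vx ?eqxx ?orbT.
  rewrite fE (negPf (vpv' x vx)) /= negb_and negbK => /orP[/eqP vu|fx].
    rewrite sP // -?vu 1?eq_sym //; move/negbT: nm.
    by rewrite /moved -vu eqxx eq_sym vx /= -leqNgt.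
  by rewrite (vf_bads vf) ?fx ?orbT.
Qed.

(** The loser supplies the one rank that the increment newly demands of [w]. As [w] has no virtual
    parent, its larger rank disturbs nothing above it; as [w] is full, [l] stops being charged. *)
Lemma vf_link w l : d = None -> dom w -> dom l -> w != l ->
  parents arcs w = 0 -> parents arcs l = 0 -> rk w = rk l -> full w ->
  dom' =1 dom -> full' =1 full ->
  (forall x, rk' x = rk x + (x == w)) ->
  exists vp', virtual_forest dom' full' rk' ((w, l) :: arcs) vp' (rem l bads) None.
Proof.
move=> d0 dw dl wl w0 l0 rwl fw dE fE rE.
have vw := vp_parentless w0; have vl := vp_parentless l0.
have sub : {subset arcs <= (w, l) :: arcs} by move=> a; rewrite inE orbC => ->.
have noloser x y : vp x = y -> x != y -> x != l.
  by move=> <-; apply: contraNneq => ->; rewrite vl.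
have nowinner x y : vp x = y -> x != y -> (x == w) = false.
  by move=> <- ne; apply: contraNF ne => /eqP ->; rewrite vw.
exists (fun x => if x == l then w else vp x); split.
- move=> x; have [-> _|_ ne] := eqVneq x l; first by apply: reach_arc; rewrite inE eqxx.
  exact: sub_reach sub (vf_reach vf ne).
- by move=> x; rewrite dE; have [->|_] := eqVneq x l => // /(vf_dom vf).
- move=> x; rewrite !rE; have [->|_ ne] := eqVneq x l.
    by rewrite eqxx rwl (eq_sym l) (negPf wl); lia.
  have := vf_rank vf ne; have := nowinner x _ erefl.
  by rewrite eq_sym ne => /(_ isT) ->; lia.
(* The old virtual children of [w] have rank less than the old [rk w = rk l], so none collides with
   [l]. *)
- have key y : y != l -> vp y != y -> w = vp y ->
      rk l + (l == w) = rk y + (y == w) -> l = y.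
    move=> yl ne e; have := vf_rank vf ne; rewrite -e rwl.
    have := nowinner y _ erefl; rewrite eq_sym ne => /(_ isT) ->.
    rewrite (eq_sym l) (negPf wl); lia.
  move=> x y; rewrite !rE; have [->|xl] := eqVneq x l; have [->|yl] := eqVneq y l => //.
  + by move=> _; apply: key.
  + by move=> ne _ /esym e /esym f; apply/esym; apply: key f.
  move=> nx ny; have := nowinner x _ erefl; rewrite eq_sym nx => /(_ isT) ->.
  have := nowinner y _ erefl; rewrite eq_sym ny => /(_ isT) ->.
  by rewrite !addn0; apply: (vf_inj vf).
- move=> x i; rewrite dE fE rE => dx _; have [->|xw] := eqVneq x w; last first.
    rewrite addn0 => ix fx; have [|y [vy yx ry]] := vf_children vf dx _ ix fx.
      by rewrite d0.
    exists y; rewrite (negPf (noloser _ _ vy yx)) rE (nowinner _ _ vy yx); split=> //.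
    by rewrite addn0.
  rewrite addn1 ltnS leq_eqVlt => /orP[/eqP ->|iw] _.
    by exists l; rewrite eqxx eq_sym wl rE eq_sym (negPf wl) addn0 rwl.
  have [||y [vy yx ry]] := vf_children vf dw _ iw; [by rewrite d0|by rewrite fw|].
  exists y; rewrite (negPf (noloser _ _ vy yx)) rE (nowinner _ _ vy yx); split=> //.
  by rewrite addn0.
- by [].
- move=> x; rewrite dE fE => dx; have [->|xl bx] := eqVneq x l.
    by rewrite (negPf wl) fw.
  rewrite -has_pred1 has_count count_mem_rem eq_sym (negPf xl) subn0.
  by rewrite -has_count has_pred1; apply: (vf_bads vf).
Qed.

(** The virtual children of the hollow [u] are bad already, so turning them into virtual roots adds
    no charge. *)
Lemma vf_start_destroy u : d = None -> ~~ full u -> parents arcs u = 0 ->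
  exists vp', virtual_forest dom full rk arcs vp' bads (Some u).
Proof.
move=> d0 fu u0; exists (fun x => if vp x == u then x else vp x); split.
- by move=> w; case: ifP => [|_]; [rewrite eqxx|apply: (vf_reach vf)].
- by move=> w; case: ifP => [|_]; [rewrite eqxx|apply: (vf_dom vf)].
- by move=> w; case: ifP => [|_]; [rewrite eqxx|apply: (vf_rank vf)].
- move=> w w'; case: ifP => [|_]; first by rewrite eqxx.
  by case: ifP => [|_]; [rewrite eqxx|apply: (vf_inj vf)].
- move=> x i dx xu ix fx; have [|w [vw wx rw]] := vf_children vf dx _ ix fx.
    by rewrite d0.
  exists w; rewrite vw ifF //; apply: contraNF xu => /eqP ->; exact: eqxx.
- move=> w; case: ifP => [|vu _]; first by rewrite eqxx.
  by apply/eqP => -[] e; rewrite e eqxx in vu.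
- move=> x dx; case: ifP => [/eqP vu _|_]; last exact: (vf_bads vf).
  by apply: (vf_bads vf) => //; rewrite vu fu orbT.
Qed.

Lemma vf_end_destroy u : d = Some u -> parents arcs u = 0 ->
  (forall x, dom' x = (x != u) && dom x) ->
  (forall x, x != u -> full' x = full x) -> (forall x, x != u -> rk' x = rk x) ->
  virtual_forest dom' full' rk' arcs vp (rem u bads) None.
Proof.
move=> du u0 dE fE rE; have vu := vp_parentless u0.
have nu w : vp w != w -> (w != u) * (vp w != u).
  move=> vw; split; first by apply: contraNneq vw => ->; rewrite vu.
  by have := vf_destroyed vf vw; rewrite du; apply: contraNneq => ->.
split.
- exact: (vf_reach vf).
- by move=> w vw; rewrite dE (vf_dom vf vw) nu.
- by move=> w vw; rewrite !rE ?(nu w) //; apply: (vf_rank vf).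
- by move=> w w' vw vw'; rewrite !rE ?(nu w) ?(nu w') //; apply: (vf_inj vf).
- move=> x i; rewrite dE => /andP[xu dx] _; rewrite rE ?fE // => ix fx.
  have [|w [vw wx rw]] := vf_children vf dx _ ix fx.
    by rewrite du; apply: contra_neq xu => -[].
  by exists w; split=> //; rewrite rE // (nu w) // vw eq_sym.
- by [].
- move=> x; rewrite dE => /andP[xu dx] bx.
  rewrite -has_pred1 has_count count_mem_rem eq_sym (negPf xu) subn0.
  rewrite -has_count has_pred1; apply: (vf_bads vf) => //.
  by have [//|vx] := eqVneq; move: bx; rewrite (negPf vx) fE ?(nu x).
Qed.

End Updates.

End VirtualForest.

(** * The dag and its roots *)

(** [arcs] lists the arcs of the dag with the given [kids]; [cap] bounds the
    number of parents of a node, and is 0 for an address not in use. *)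
Record well_linked (full : pred nat) (cap : nat -> nat) (kids : nat -> seq nat)
    (arcs : seq (nat * nat)) : Prop := WellLinked {
  wl_arcs u v : count_mem (u, v) arcs = count_mem v (kids u);
  wl_parents v : parents arcs v <= cap v;
  wl_full v : full v -> cap v <= 1 }.

Section WellLinked.

Variables (full : pred nat) (cap : nat -> nat) (kids : nat -> seq nat).
Variable arcs : seq (nat * nat).
Hypothesis wl : well_linked full cap kids arcs.

Lemma mem_arcs u v : ((u, v) \in arcs) = (v \in kids u).
Proof. by rewrite -!has_pred1 !has_count (wl_arcs wl). Qed.

Variables (full' : pred nat) (cap' : nat -> nat) (kids' : nat -> seq nat).
Hypothesis full_cap' : forall v, full' v -> cap' v <= 1.

Lemma wl_same : kids' =1 kids -> (forall v, cap v <= cap' v) ->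
  well_linked full' cap' kids' arcs.
Proof.
move=> kE cE; split=> // [u v|v]; first by rewrite kE (wl_arcs wl).
exact: leq_trans (wl_parents wl v) (cE v).
Qed.

Lemma wl_add_arc u v :
  (forall x, kids' x = if x == u then v :: kids x else kids x) ->
  (forall x, cap x <= cap' x) -> parents arcs v < cap' v ->
  well_linked full' cap' kids' ((u, v) :: arcs).
Proof.
move=> kE cE pv; split=> // [x y|x]; last first.
  rewrite parents_cons; have [<-//|_] := eqVneq.
  exact: leq_trans (wl_parents wl x) (cE x).
rewrite /= (wl_arcs wl) kE xpair_eqE (eq_sym u).
by case: (x == u).
Qed.

Lemma wl_remove_arc u v cs : kids u = v :: cs ->
  (forall x, kids' x = if x == u then cs else kids x) ->
  (forall x, cap x <= cap' x + (v == x)) ->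
  well_linked full' cap' kids' (rem (u, v) arcs).
Proof.
move=> ku kE cE.
have uv : (u, v) \in arcs by rewrite mem_arcs ku mem_head.
split=> // [x y|x].
  rewrite count_mem_rem (wl_arcs wl) kE xpair_eqE (eq_sym u).
  have [->|_] := eqVneq x u; last by rewrite subn0.
  by rewrite ku /= addKn.
rewrite parents_rem // leq_subLR addnC.
exact: leq_trans (wl_parents wl x) (cE x).
Qed.

Lemma wl_remove u : kids u = [::] -> parents arcs u = 0 ->
  (forall x, kids' x = if x == u then [::] else kids x) ->
  (forall x, x != u -> cap x <= cap' x) ->
  well_linked full' cap' kids' arcs.
Proof.
move=> ku u0 kE cE; split=> // [x y|x].
  by rewrite (wl_arcs wl) kE; have [->|//] := eqVneq; rewrite ku.
have [->|xu] := eqVneq x u; first by rewrite u0.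
exact: leq_trans (wl_parents wl x) (cE x xu).
Qed.

End WellLinked.

Import Order.Theory.

Local Open Scope fset_scope.
Local Open Scope fmap_scope.


Section Roots.

Implicit Types (dom : pred nat) (arcs : seq (nat * nat)).
Implicit Types (H : {fmap nat -> option nat}) (L : seq nat).

(** [L] collects the roots outside the table of heaps, in hand or in the array. Its disjointness
    from the table ensures that linking two of them buries no root of another heap. *)
Record rooted dom arcs H L : Prop := Rooted {
  rt_uniq : uniq L;
  rt_live u : u \in L -> dom u /\ parents arcs u = 0;
  rt_heap h u : H.[? h] = Some (Some u) ->
    [/\ dom u, parents arcs u = 0 & u \notin L];
  rt_inj h h' u : H.[? h] = Some (Some u) -> H.[? h'] = Some (Some u) -> h = h' }.

Lemma rooted_sub dom arcs H L L' : rooted dom arcs H L -> uniq L' ->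
  {subset L' <= L} -> rooted dom arcs H L'.
Proof.
move=> rt uL sub; split=> // [u /sub|h u hu|]; [exact: (rt_live rt)| |exact: (rt_inj rt)].
by have [? ? uL'] := rt_heap rt hu; split=> //; apply: contra uL' => /sub.
Qed.

Lemma rooted_perm dom arcs H L L' : rooted dom arcs H L -> perm_eq L L' ->
  rooted dom arcs H L'.
Proof.
move=> rt p; apply: (rooted_sub rt); first by rewrite -(perm_uniq p) (rt_uniq rt).
by move=> x; rewrite (perm_mem p).
Qed.

Lemma rooted_change dom arcs H L dom' arcs' : rooted dom arcs H L ->
  (forall u, dom u -> parents arcs u = 0 ->
     u \in L \/ (exists h, H.[? h] = Some (Some u)) ->
     dom' u /\ parents arcs' u = 0) ->
  rooted dom' arcs' H L.
Proof.
move=> rt ch; split; [exact: (rt_uniq rt)| | |exact: (rt_inj rt)].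
  by move=> u uL; have [du pu] := rt_live rt uL; apply: ch => //; left.
move=> h u hu; have [du pu uL] := rt_heap rt hu.
by have [|? ?] := ch u du pu; first by right; exists h.
Qed.

Lemma rooted_dom dom arcs H L dom' : rooted dom arcs H L ->
  (forall u, dom u -> dom' u) -> rooted dom' arcs H L.
Proof. by move=> rt sub; apply: (rooted_change rt) => u /sub. Qed.

Lemma rooted_link dom arcs H L w l : rooted dom arcs H L -> l \in L ->
  rooted dom ((w, l) :: arcs) H (rem l L).
Proof.
move=> rt lL; have uL := rt_uniq rt.
apply: (rooted_change (rooted_sub rt (rem_uniq l uL) (@mem_rem _ l L))).
move=> u du pu; rewrite parents_cons pu addn0 => ur; split=> //.
case: eqP => // lu; move: ur; rewrite -lu mem_rem_uniqF // => -[|[h /(rt_heap rt)]] //.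
by rewrite lL => -[].
Qed.

Lemma rooted_new dom arcs H L u : rooted dom arcs H L -> ~~ dom u ->
  parents arcs u = 0 -> rooted (fun x => (x == u) || dom x) arcs H (u :: L).
Proof.
move=> rt du pu; split.
- rewrite /= (rt_uniq rt) andbT; apply: contra du => /(rt_live rt)[] //.
- by move=> x; rewrite inE; case: eqP => [->|_ /(rt_live rt)].
- move=> h x /(rt_heap rt)[dx px xL]; rewrite inE negb_or xL dx orbT andbT; split=> //.
  by apply: contraNneq du => <-.
- exact: (rt_inj rt).
Qed.

Lemma rooted_cons dom arcs H L u : rooted dom arcs H L -> dom u ->
  parents arcs u = 0 -> u \notin L -> (forall h, H.[? h] <> Some (Some u)) ->
  rooted dom arcs H (u :: L).
Proof.
move=> rt du pu uL uH; split; [|move=> x|move=> h x hx|exact: (rt_inj rt)].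
- by rewrite /= uL (rt_uniq rt).
- by rewrite inE => /orP[/eqP ->|/(rt_live rt)].
have [dx px xL] := rt_heap rt hx; split=> //; rewrite inE negb_or xL andbT.
by apply: contra_notN (uH h) => /eqP <-.
Qed.

Lemma rooted_behead dom dom' arcs H L u : rooted dom arcs H (u :: L) ->
  (forall x, dom' x = (x != u) && dom x) -> rooted dom' arcs H L.
Proof.
move=> rt dE; have /andP[uL uniqL] := rt_uniq rt.
have sub : {subset L <= u :: L} by move=> x; rewrite inE orbC => ->.
apply: (rooted_change (rooted_sub rt uniqL sub)) => x dx px xr.
rewrite dE dx andbT; split=> //; case: xr => [xL|[h /(rt_heap rt)[_ _]]].
  by apply: contraNneq uL => <-.
by rewrite inE negb_or => /andP[].
Qed.

Definition olist (r : option nat) := if r is Some u then [:: u] else [::].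

Lemma rooted_take dom arcs H L h r : rooted dom arcs H L -> H.[? h] = Some r ->
  rooted dom arcs H.[~ h] (olist r ++ L).
Proof.
move=> rt hr; split.
- rewrite cat_uniq (rt_uniq rt) andbT; case: r hr => [u|] hr //=.
    rewrite -all_predC; apply/allP => x xL /=; rewrite inE.
    by have [_ _] := rt_heap rt hr; apply: contraNneq => <-.
  by rewrite -all_predC; apply/allP.
- move=> u; rewrite mem_cat => /orP[|/(rt_live rt)//].
  case: r hr => [v|] // hr; rewrite inE => /eqP ->.
  by have [] := rt_heap rt hr.
- move=> h' u; rewrite fnd_rem1; case: eqP => // hh hu.
  have [du pu uL] := rt_heap rt hu; split=> //; rewrite mem_cat negb_or uL andbT.
  case: r hr => [v|] // hr; rewrite inE; apply/eqP => uv; apply: hh.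
  by apply: (rt_inj rt) hu _; rewrite uv.
- move=> h1 h2 u; rewrite !fnd_rem1; case: eqP => // _; case: eqP => // _.
  exact: (rt_inj rt).
Qed.

Lemma rooted_put dom arcs H h r : rooted dom arcs H (olist r) -> h \notin domf H ->
  rooted dom arcs H.[h <- r] [::].
Proof.
move=> rt hH; split=> // [h' u|h1 h2 u].
  rewrite fnd_set; case: eqP => [_ [ru]|_ /(rt_heap rt)[]] //.
  by have [|? ?] := rt_live rt (u := u); [rewrite ru mem_head|split].
have old h' : H.[? h'] = Some (Some u) -> Some r <> Some (Some u).
  by move=> /(rt_heap rt)[_ _ ur] [e]; rewrite e mem_head in ur.
rewrite !fnd_set; case: eqP => [->|_]; case: eqP => [->|_] //.
- by move=> ru /old.
- by move=> /old.
exact: (rt_inj rt).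
Qed.

End Roots.

(** * Reading ranks, arcs and dags off the store *)

Section Memory.

Context {disp : Order.disp_t} {K : orderType disp} {E : Type}.

Implicit Types (m : memory K E) (n : node K E) (e : E) (k : K) (u v w x : nat).

Implicit Types (H : {fmap nat -> option nat}) (A : {fmap nat -> nat}).
Implicit Types (arcs : seq (nat * nat)) (vp : nat -> nat).
Implicit Types (bads vs L : seq nat) (M : nat).

Definition get T (f : node K E -> T) (t : T) m u :=
  if m.[? u] is Some n then f n else t.

Notation dom := (get (fun _ => true) false).
Notation full := (get (fun n => isSome (item n)) false).
Notation rk := (get (@rank _ K E) 0).
Notation kids := (get (@children _ K E) [::]).
Notation cap := (get (fun n => (two_parents n).+1) 0).

Lemma get_some T (f : node K E -> T) t m u n : m.[? u] = Some n -> get f t m u = f n.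
Proof. by rewrite /get => ->. Qed.

Lemma get_set T (f : node K E -> T) t m u n x :
  get f t m.[u <- n] x = if x == u then f n else get f t m x.
Proof. by rewrite /get fnd_set; case: eqP. Qed.

Lemma get_rem T (f : node K E -> T) t m u x :
  get f t m.[~ u] x = if x == u then t else get f t m x.
Proof. by rewrite /get fnd_rem1; case: eqP. Qed.

Lemma get_update T (f : node K E -> T) t m u g x :
  get f t (update u g m) x =
  if x == u then get (fun n => f (g n)) t m u else get f t m x.
Proof.
rewrite /update; case mu: m.[? u] => [n|]; first by rewrite get_set (get_some _ _ mu).
by case: eqP => // ->; rewrite /get mu.
Qed.

Lemma get_update_id T (f : node K E -> T) t m u g x : (forall n, f (g n) = f n) ->
  get f t (update u g m) x = get f t m x.
Proof.
move=> fg; rewrite get_update; case: eqP => // ->.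
by rewrite /get; case: m.[? u].
Qed.

Lemma domE m u : dom m u = (u \in domf m).
Proof. by rewrite -fndSome /get; case: m.[? u]. Qed.

Lemma get_undef T (f : node K E -> T) t m u : ~~ dom m u -> get f t m u = t.
Proof. by rewrite /get; case: m.[? u]. Qed.

Lemma dom_get m u : dom m u -> exists n, m.[? u] = Some n.
Proof. by rewrite /get; case: m.[? u] => // n; exists n. Qed.

Lemma full_dom m u : full m u -> dom m u.
Proof. by rewrite /get; case: m.[? u]. Qed.

Definition linked m arcs := well_linked (full m) (cap m) (kids m) arcs.

Lemma linked_dom m arcs u v : linked m arcs -> (u, v) \in arcs -> dom m v.
Proof.
move=> wl /parents_gt0; have := wl_parents wl v.
by rewrite /get; case: m.[? v] => //=; case: parents.
Qed.

Lemma link_dom m u v w m' : link m u v w m' ->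
  [/\ dom m u, dom m v &
      exists l, [/\ (w = u /\ l = v) \/ (w = v /\ l = u) & m' = add_child w l m]].
Proof.
have aux a b : key_le m a b -> dom m a /\ dom m b.
  by rewrite /key_le /get; case: m.[? a] => // ?; case: m.[? b].
by case=> /aux[? ?]; split=> //; [exists v; split=> //; left|exists u; split=> //; right].
Qed.

Lemma dag_nodesP m (r : nat) u : u \in dag_nodes m (Some r) ->
  dom m u /\ forall S : pred nat,
    (forall x y, dom m y -> has_arc m x y -> S x -> S y) -> S r -> S u.
Proof.
rewrite /dag_nodes /=; case: insubP => [x rm xr|] //=.
case/imfsetP => y /= /connectP[p pth ->] ->; split.
  by rewrite domE; apply: valP.
rewrite -xr; elim: p x {rm xr} pth => //= z p IH x /andP[xz pz] S cl Sx.
apply: IH => //; apply: cl xz Sx; rewrite domE; exact: valP.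
Qed.

Lemma dag_nodes_root m u : dom m u -> u \in dag_nodes m (Some u).
Proof.
rewrite domE /dag_nodes /= => du; case: insubP => [x _ xu|/negP//] /=.
by apply/imfsetP; exists x => //=; rewrite inE connect0.
Qed.

Lemma has_arcE m arcs u v : linked m arcs -> has_arc m u v = ((u, v) \in arcs).
Proof. by move=> wl; rewrite (mem_arcs wl) /has_arc /get; case: m.[? u]. Qed.

Lemma dag_nodes_closed m arcs r : linked m arcs ->
  closed arcs (mem (enum_fset (dag_nodes m r))).
Proof.
move=> wl u v uv; have dv := linked_dom wl uv.
rewrite -(has_arcE _ _ wl) in uv; change (u \in dag_nodes m r -> v \in dag_nodes m r).
rewrite /dag_nodes; case: obind => [x|] //= /imfsetP[y /= xy uy].
rewrite domE in dv; apply/imfsetP; exists [` dv] => //=.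
rewrite inE; apply: connect_trans xy _; apply: connect1.
by rewrite /= -uy.
Qed.

Lemma dag_nodes_reach m arcs r u : linked m arcs ->
  u \in dag_nodes m (Some r) -> reach arcs r u.
Proof.
move=> wl /dag_nodesP[_ ru] S cl; apply: ru => x y _.
by rewrite (has_arcE _ _ wl); apply: cl.
Qed.

(** * The potential *)

(** A decrease-key below the root takes 1 for its arc, 15 for three bad nodes, 3 to meld and 1 for
    the transition: 20. With [N] the logarithm and [M = 2N + 1], deleting a root takes at most [5M]
    for bad nodes, [6M + 15] for the phases and 1 for the transition, that is [22N + 27], at most
    [27(N + 1)]. *)
Definition cost (o : option (operation K E)) (s : state K E) : nat :=
  if o is Some o then amortized_time 20 27 (o, s) else 0.

Definition destroyed (c : @control E) : option nat :=
  if c is Destroying u _ _ then Some u else None.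

(** The roots that are not in the array nor in the table of heaps. *)
Definition loose_roots (c : @control E) : seq nat :=
  match c with
  | Return r => olist r
  | Melding r1 r2 => olist r1 ++ olist r2
  | Choosing hs fs => hs ++ fs
  | Destroying u hs fs => u :: hs ++ fs
  | Placing fs _ => fs
  | Ranking u fs _ => u :: fs
  | Scanning _ _ rs => rs
  | Uniting rs => rs
  | _ => [::]
  end.

(** This pays for what arcs and bad nodes do not. Cutting an arc is paid by the arc. A scanned entry
    has 3 units: 1 for the visit and 2 for a root found there, which later needs an unranked link
    and the arc it creates. *)
Definition control_potential (c : @control E) (vs : seq nat) (M : nat) : nat :=
  match c with
  | Idle => 0
  | Answer _ | Return _ => 1
  | Melding _ _ => 3
  | Choosing _ _ => 6 * M + 15
  | Destroying _ _ _ => 6 * M + 14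
  | Placing _ _ => 3 * (M.+2 - size vs) + 3 * M + 7
  | Ranking _ _ _ => 3 * (M.+2 - size vs) + 3 * M + 6
  | Scanning i _ rs => 3 * (M.+1 - i) + 2 * size rs + 3
  | Uniting rs => 2 * size rs + 2
  end.

(** The nodes of [L] remain within a set of nodes that is too small for a node
    of rank more than [M]. *)
Definition confined arcs (L : seq nat) (M : nat) : Prop :=
  exists S : seq nat, [/\ closed arcs (mem S), {subset L <= S} &
    forall r, 2 ^ r./2 <= size S -> r <= M].

(** Fullness of the roots to be ranked makes every winner a full virtual parent. The bound [b] on
    the ranks in the array ensures that a scan stopping at [b] leaves it empty for the next
    delete. *)
Definition control_ok m arcs (c : @control E) (vs : seq nat) (M : nat) : Prop :=
  match c with
  | Choosing hs fs =>
    [/\ vs = [::], confined arcs (hs ++ fs) M,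
        forall u, u \in hs -> ~~ full m u & forall u, u \in fs -> full m u]
  | Destroying u hs fs =>
    [/\ vs = [::], confined arcs (u :: hs ++ fs) M,
        forall v, v \in u :: hs -> ~~ full m v &
        forall u, u \in fs -> full m u]
  | Placing fs b =>
    [/\ confined arcs (fs ++ vs) M, forall u, u \in fs ++ vs -> full m u,
        b <= M & forall v, v \in vs -> rk m v <= b]
  | Ranking u fs b =>
    [/\ confined arcs (u :: fs ++ vs) M,
        forall v, v \in u :: fs ++ vs -> full m v,
        b <= M & forall v, v \in vs -> rk m v <= b]
  | Scanning i b rs => b <= M /\ forall v, v \in vs -> i <= rk m v <= b
  | _ => vs = [::]
  end.

(** [vs] lists the roots in the array, [M] bounds their ranks. *)
Record valid m H A c arcs vp bads vs M : Prop := Valid {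
  va_linked : linked m arcs;
  va_forest : virtual_forest (dom m) (full m) (rk m) arcs vp bads (destroyed c);
  va_rooted : rooted (dom m) arcs H (loose_roots c ++ vs);
  va_array i v : A.[? i] = Some v <-> v \in vs /\ rk m v = i;
  va_control : control_ok m arcs c vs M }.

(** Of the 5 units carried by a node in [bads], a ranked link that frees one
    spends 1 on itself, 1 on the arc it creates, and 3 on putting another root
    in the array entry it empties. *)
Definition invariant (s : state K E) (p : nat) : Prop :=
  exists arcs vp bads vs M,
    valid (store s) (heaps s) (array s) (ctl s) arcs vp bads vs M /\
    size arcs + 5 * size bads + control_potential (ctl s) vs M <= p.

Lemma confined_sub arcs arcs' L L' M : {subset arcs' <= arcs} ->
  {subset L' <= L} -> confined arcs L M -> confined arcs' L' M.
Proof.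
move=> asub Lsub [S [cl sub SM]]; exists S; split=> //.
- exact: sub_closed cl.
- by move=> x /Lsub/sub.
Qed.

Lemma confined_link arcs L M w l : l \in L -> confined arcs L M ->
  confined ((w, l) :: arcs) L M.
Proof.
move=> lL [S [cl sub SM]]; exists S; split=> // x y.
rewrite inE => /orP[/eqP[_ ->] _|/cl//]; exact: sub.
Qed.

Lemma confined_arc arcs L M u v : (u, v) \in arcs -> u \in L ->
  confined arcs L M -> confined arcs (v :: L) M.
Proof.
move=> uv uL [S [cl sub SM]]; exists S; split=> // x.
rewrite inE => /orP[/eqP->|/sub//]; exact: (cl _ _ uv (sub _ uL)).
Qed.

Lemma confined_rank m arcs vp bads L M u :
  virtual_forest (dom m) (full m) (rk m) arcs vp bads None ->
  confined arcs L M -> dom m u -> u \in L -> rk m u <= M.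
Proof.
move=> vf [S [cl sub SM]] du uL; apply: SM.
exact: (virtual_tree_size vf) (sub _ uL).
Qed.

(** From [2 ^ k./2 <= n] follows [k./2 <= trunc_log 2 n]; the extra 1 after doubling covers odd
    [k]. *)
Lemma dag_nodes_confined m arcs r : linked m arcs ->
  confined arcs (enum_fset (dag_nodes m r))
    (trunc_log 2 #|` dag_nodes m r|).*2.+1.
Proof.
move=> wl; exists (enum_fset (dag_nodes m r)); split=> // [|k].
  exact: dag_nodes_closed.
move=> /(trunc_log_max (ltnSn 1)); move: (trunc_log _ _) => t; lia.
Qed.

Lemma undef_parentless m arcs u : linked m arcs -> ~~ dom m u -> parents arcs u = 0.
Proof.
move=> wl du; apply/eqP; rewrite -leqn0.
by rewrite -(get_undef (fun n => (two_parents n).+1) 0 du) (wl_parents wl).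
Qed.

(** The array holds one root per index, so the roots in it have distinct ranks. *)
Lemma array_size m H A c arcs vp bads vs M :
  valid m H A c arcs vp bads vs M ->
  (forall v, v \in vs -> rk m v <= M) -> size vs <= M.+1.
Proof.
move=> va vM; rewrite -(size_map (rk m)) -(size_iota 0 M.+1).
have := rt_uniq (va_rooted va); rewrite cat_uniq => /and3P[_ _ uvs].
apply: uniq_leq_size.
  rewrite map_inj_in_uniq // => x y xv yv e.
  have hx := iffRL (va_array va _ _) (conj xv e).
  have hy := iffRL (va_array va _ _) (conj yv erefl).
  by move: hy; rewrite hx => -[].
by move=> i /mapP[v /vM vM' ->]; rewrite mem_iota.
Qed.

Lemma linked_link m arcs w l : linked m arcs -> dom m w -> dom m l ->
  parents arcs l = 0 -> linked (add_child w l m) ((w, l) :: arcs).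
Proof.
move=> wl dw dl l0; have [n mw] := dom_get dw.
have capE x : cap (add_child w l m) x = cap m x by rewrite get_update_id.
have fullE x : full (add_child w l m) x = full m x by rewrite get_update_id.
apply: (wl_add_arc wl) => [x|x|x|].
- by rewrite fullE capE; apply: (wl_full wl).
- rewrite get_update; case: eqP => // ->; by rewrite !(get_some _ _ mw).
- by rewrite capE.
- by rewrite capE l0; have [k mk] := dom_get dl; rewrite (get_some _ _ mk).
Qed.

(** [vp] and [bads] are unchanged: the loser stays charged, so the new arc has to be paid by the
    phase. *)
Lemma valid_unranked_link m H A c c' arcs vp bads vs M w l :
  valid m H A c arcs vp bads vs M -> destroyed c = None -> destroyed c' = None ->
  dom m w -> l \in loose_roots c ->
  loose_roots c' = rem l (loose_roots c) ->
  control_ok (add_child w l m) ((w, l) :: arcs) c' vs M ->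
  valid (add_child w l m) H A c' ((w, l) :: arcs) vp bads vs M.
Proof.
move=> va d0 d0' dw lL LE ok.
have lL' : l \in loose_roots c ++ vs by rewrite mem_cat lL.
have [dl l0] := rt_live (va_rooted va) lL'.
split=> //.
- exact: linked_link (va_linked va) _ _ _.
- rewrite d0' -d0; apply: (vf_same (va_forest va)) => [x|x|x|x y _];
    rewrite ?get_update_id //.
  by apply: sub_reach => a; rewrite inE orbC => ->.
- have := rooted_link w (va_rooted va) lL'; rewrite LE.
  have -> : rem l (loose_roots c ++ vs) = rem l (loose_roots c) ++ vs.
    elim: (loose_roots c) lL => //= a s IH; rewrite inE eq_sym.
    by case: eqP => //= _ /IH ->.
  by move/rooted_dom; apply => u; rewrite get_update_id.
- move=> i v; rewrite get_update_id //; exact: (va_array va).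
Qed.

(** * The transitions *)

Arguments amortized_time {_ _ _} _ _ !_ /.

Lemma invariantI m H A c arcs vp bads vs M q :
  valid m H A c arcs vp bads vs M ->
  size arcs + 5 * size bads + control_potential c vs M < q ->
  exists2 p, invariant (State m H A c) p & p < q.
Proof. by move=> va lt; eexists; last exact: lt; exists arcs, vp, bads, vs, M. Qed.

(** The strict inequality accounts for the unit of time of the transition. *)
Definition pays (s : state K E) o (s' : state K E) :=
  forall p, invariant s p -> exists2 p', invariant s' p' & p' < p + cost o s.

Lemma valid_move m H A A' c c' arcs vp bads vs vs' M :
  valid m H A c arcs vp bads vs M -> destroyed c' = destroyed c ->
  perm_eq (loose_roots c ++ vs) (loose_roots c' ++ vs') ->
  (forall i v, A'.[? i] = Some v <-> v \in vs' /\ rk m v = i) ->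
  control_ok m arcs c' vs' M ->
  valid m H A' c' arcs vp bads vs' M.
Proof.
move=> va dE pE AE ok; split=> //.
- exact: (va_linked va).
- by rewrite dE; apply: (va_forest va).
- exact: rooted_perm (va_rooted va) pE.
Qed.

Lemma array_same m m' H A c arcs vp bads vs M :
  valid m H A c arcs vp bads vs M ->
  (forall v, v \in vs -> rk m' v = rk m v) ->
  forall i v, A.[? i] = Some v <-> v \in vs /\ rk m' v = i.
Proof.
move=> va rE i v; split=> [/(va_array va)[vvs rv]|[vvs rv]].
  by rewrite rE.
by apply/(va_array va); rewrite -rE.
Qed.

Lemma valid_uniq_array m H A c arcs vp bads vs M :
  valid m H A c arcs vp bads vs M -> uniq vs.
Proof. by move=> va; have := rt_uniq (va_rooted va); rewrite cat_uniq => /and3P[]. Qed.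

Lemma array_rem m H A c arcs vp bads vs M i u :
  valid m H A c arcs vp bads vs M -> A.[? i] = Some u ->
  forall j v, (A.[~ i]).[? j] = Some v <-> v \in rem u vs /\ rk m v = j.
Proof.
move=> va Au j v; have [uvs ru] := iffLR (va_array va _ _) Au.
rewrite fnd_rem1 mem_rem_uniq ?(valid_uniq_array va) // inE.
have [->|ji] := eqVneq j i; last split.
- split=> // -[/andP[vu vv] rv]; case/eqP: vu.
  have := iffRL (va_array va _ _) (conj vv rv).
  by rewrite Au => -[].
- move=> /(va_array va)[vv rv]; split=> //; rewrite vv andbT.
  by apply: contraNneq ji => vu; rewrite -rv vu ru.
- by case=> /andP[_ vv] rv; apply/(va_array va).
Qed.

Lemma pays_make_heap m H A :
  pays (State m H A Idle) (Some MakeHeap) (State m H A (Return None)).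
Proof.
move=> p [arcs [vp [bads [vs [M [/= va pot]]]]]].
apply: (invariantI (valid_move (c' := Return None) va _ _ _ _)) => //=.
- exact: (va_array va).
- exact: (va_control va).
- lia.
Qed.

Lemma pays_find_min m H A h (y : option E) :
  pays (State m H A Idle) (Some (FindMin h)) (State m H A (Answer y)).
Proof.
move=> p [arcs [vp [bads [vs [M [/= va pot]]]]]].
apply: (invariantI (valid_move (c' := Answer y) va _ _ _ _)) => //=.
- exact: (va_array va).
- exact: (va_control va).
- lia.
Qed.

Lemma pays_insert m H A h r e k u : H.[? h] = Some r -> u \notin domf m ->
  pays (State m H A Idle) (Some (Insert e k h))
    (State m.[u <- Node k (Some e) 0 [::] false] H.[~ h] A (Melding (Some u) r)).
Proof.
move=> hr; rewrite -domE => du p [arcs [vp [bads [vs [M [/= va pot]]]]]].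
have ru : rk m u = 0 by rewrite get_undef.
have vs0 : vs = [::] := va_control va.
have u0 := undef_parentless (va_linked va) du.
apply: (@invariantI _ _ _ _ arcs vp (u :: bads) vs M); last by rewrite /=; lia.
split.
- apply: (wl_same (va_linked va)) => x; rewrite !get_set; case: eqP => //.
  + by move=> _; apply: (wl_full (va_linked va)).
  + by move=> ->; rewrite get_undef.
  + by move=> ->; rewrite get_undef.
- apply: (vf_new (va_forest va) du ru) => // x; rewrite get_set; case: eqP => //.
  by move=> ->.
- apply: rooted_dom (rooted_new (rooted_take (va_rooted va) hr) du u0) _ => x.
  by rewrite get_set; case: eqP.
- apply: (array_same va) => v vvs; rewrite get_set; case: eqP => // vu.
  by move: vvs; rewrite vs0.
- by [].
Qed.

Lemma pays_meld m H A h1 h2 r1 r2 : h1 != h2 ->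
  H.[? h1] = Some r1 -> H.[? h2] = Some r2 ->
  pays (State m H A Idle) (Some (Meld h1 h2))
    (State m H.[~ h1].[~ h2] A (Melding r1 r2)).
Proof.
move=> h12 hr1 hr2 p [arcs [vp [bads [vs [M [/= va pot]]]]]].
apply: (@invariantI _ _ _ _ arcs vp bads vs M); last by rewrite /=; lia.
split.
- exact: (va_linked va).
- exact: (va_forest va).
- have rt := rooted_take (va_rooted va) hr1.
  have hr2' : (H.[~ h1]).[? h2] = Some r2 by rewrite fnd_rem1 eq_sym h12.
  apply: rooted_perm (rooted_take rt hr2') _.
  by rewrite /= -!catA perm_catCA.
- exact: (va_array va).
- exact: (va_control va).
Qed.

Lemma pays_decrease_key_root m H A h u e k : H.[? h] = Some (Some u) ->
  pays (State m H A Idle) (Some (DecreaseKey e u k h))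
    (State (update u (set_key k) m) H.[~ h] A (Return (Some u))).
Proof.
move=> hu p [arcs [vp [bads [vs [M [/= va pot]]]]]].
apply: (@invariantI _ _ _ _ arcs vp bads vs M); last by rewrite /=; lia.
split.
- apply: (wl_same (va_linked va)) => x; rewrite !get_update_id //.
  exact: (wl_full (va_linked va)).
- by apply: (vf_same (va_forest va)) => [x|x|x|x y] //=; rewrite get_update_id.
- apply: rooted_dom (rooted_take (va_rooted va) hu) _ => x.
  by rewrite get_update_id.
- by apply: (array_same va) => v _; rewrite get_update_id.
- exact: (va_control va).
Qed.

(** Common to the root and non-root cases: [f] hollows [u] and may set its bit. The bound on
    [parents arcs u] says that the resulting bit leaves room for the arc from [v]. *)
Lemma decrease_key_links m arcs vp bads u n v e k (f : node K E -> node K E) :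
  linked m arcs ->
  virtual_forest (dom m) (full m) (rk m) arcs vp bads None ->
  m.[? u] = Some n -> full m u -> v \notin domf m ->
  (forall n' : node K E, [/\ item (f n') = None, rank (f n') = rank n',
     children (f n') = children n' & two_parents n' <= two_parents (f n')]) ->
  parents arcs u <= two_parents (f n) ->
  let m' := (update u f m).[v <- Node k (Some e) (rank n - 2) [:: u] false] in
  [/\ linked m' ((v, u) :: arcs),
      forall x, dom m' x = (x == v) || dom m x &
      exists vp' bads', virtual_forest (dom m') (full m') (rk m')
          ((v, u) :: arcs) vp' bads' None /\ size bads' <= size bads + 3].
Proof.
move=> wl vf mu fu; rewrite -domE => dv fP pu m'.
have du := full_dom fu.
have uv : u != v by apply: contraNneq dv => <-.
have domE' x : dom m' x = (x == v) || dom m x.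
  rewrite get_set get_update; case: (x == v) => //=.
  by case: eqP => // ->; rewrite du.
have fullE x : full m' x = (x == v) || (x != u) && full m x.
  rewrite get_set get_update; case: (x == v) => //=.
  by case: eqP => // _; rewrite (get_some _ _ mu); have [-> _ _ _] := fP n.
have rkE x : rk m' x = if x == v then rk m u - 2 else rk m x.
  rewrite get_set get_update !(get_some _ _ mu); case: (x == v) => //=.
  by case: eqP => // ->; rewrite !(get_some _ _ mu); have [_ -> _ _] := fP n.
split=> //.
  apply: (wl_add_arc wl) => [x|x|x|].
  - rewrite fullE get_set get_update; case: (x == v) => //=.
    by case: eqP => // _; apply: (wl_full wl).
  - rewrite get_set get_update; have [->|_] := eqVneq x v.
      by rewrite get_undef.
    by case: eqP => // ->; rewrite !(get_some _ _ mu); have [_ _ ->] := fP n.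
  - rewrite get_set get_update; have [->|_] := eqVneq x v.
      by rewrite get_undef.
    by case: eqP => // ->; rewrite !(get_some _ _ mu); have [_ _ _] := fP n.
  - by rewrite get_set get_update (negPf uv) eqxx (get_some _ _ mu) ltnS.
(* At most [rk u - (rk u - 2) <= 2] children turn bad; [v] is the third. *)
have [s sz sP] := virtual_children_seq vf u (rk m u - 2) (domE m).
have [||vp' vf'] := vf_decrease_key vf erefl du fu dv _ _ domE' fullE rkE erefl sP.
- by rewrite get_undef.
- by rewrite get_undef.
exists vp', (v :: s ++ bads); split=> //=; rewrite size_cat; lia.
Qed.

Lemma pays_decrease_key_new_root m H A h u n e k v :
  H.[? h] = Some (Some u) -> holds m H h u e -> m.[? u] = Some n ->
  v \notin domf m ->
  pays (State m H A Idle) (Some (DecreaseKey e u k h))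
    (State (update u make_hollow m)
         .[v <- Node k (Some e) (rank n - 2) [:: u] false]
       H.[~ h] A (Return (Some v))).
Proof.
move=> hu [_ ue] mu dv p [arcs [vp [bads [vs [M [/= va pot]]]]]].
have fu : full m u by move: ue; rewrite /get mu /= => ->.
have [du u0 _] := rt_heap (va_rooted va) hu.
have vs0 : vs = [::] := va_control va.
have [||wl' dE [vp' [bads' [vf' sz]]]] := decrease_key_links (f := @make_hollow _ K E)
    e k (va_linked va) (va_forest va) mu fu dv.
- by move=> x; split.
- by rewrite u0.
apply: (@invariantI _ _ _ _ ((v, u) :: arcs) vp' bads' vs M); last first.
  rewrite /=; lia.
rewrite -domE in dv; have v0 := undef_parentless (va_linked va) dv.
split=> //.
- have rt := rooted_new (rooted_take (va_rooted va) hu) dv v0.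
  have /rooted_sub : rooted (fun x => (x == v) || dom m x) ((v, u) :: arcs)
      H.[~ h] (rem u (v :: olist (Some u) ++ vs)).
    by apply: rooted_link; rewrite // !inE eqxx orbT.
  rewrite vs0 => rt'; apply: (rooted_dom (rt' _ _ _)) => //.
  + rewrite /=; case: eqP => [vu|_]; first by rewrite vu du in dv.
    by move=> x; rewrite eqxx !inE => /eqP ->; rewrite eqxx.
  + by move=> x; rewrite dE.
- by apply: (array_same va) => x; rewrite vs0.
Qed.

Lemma pays_decrease_key m H A h w u n e k v :
  H.[? h] = Some (Some w) -> u != w -> holds m H h u e -> m.[? u] = Some n ->
  v \notin domf m ->
  pays (State m H A Idle) (Some (DecreaseKey e u k h))
    (State (update u (fun n' : node K E => set_two_parents true (make_hollow n')) m)
         .[v <- Node k (Some e) (rank n - 2) [:: u] false]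
       H.[~ h] A (Melding (Some v) (Some w))).
Proof.
move=> hw uw [uh ue] mu dv p [arcs [vp [bads [vs [M [/= va pot]]]]]].
have fu : full m u by move: ue; rewrite /get mu /= => ->.
have wu : reach arcs w u.
  by move: uh; rewrite /heap_nodes hw; apply: dag_nodes_reach (va_linked va).
(* Being reached from another node, [u] has a parent already, so the arc into it spoils no root. *)
have nroot x : parents arcs x = 0 -> (u == x) = false.
  move=> x0; apply: contra_neqF uw => /eqP ux; rewrite ux in wu *.
  by rewrite (parentless_reach x0 wu).
have vs0 : vs = [::] := va_control va.
have [||wl' dE [vp' [bads' [vf' sz]]]] :=
  decrease_key_links (f := fun n' : node K E => set_two_parents true (make_hollow n'))
    e k (va_linked va) (va_forest va) mu fu dv.
- by move=> x; split=> //=; case: two_parents.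
(* A full node has at most one parent, so the bit set here accounts for the second. *)
- exact: leq_trans (wl_parents (va_linked va) u) (wl_full (va_linked va) fu).
apply: (@invariantI _ _ _ _ ((v, u) :: arcs) vp' bads' vs M); last first.
  rewrite /=; lia.
rewrite -domE in dv; have v0 := undef_parentless (va_linked va) dv.
split=> //.
- apply: (rooted_change (rooted_new (rooted_take (va_rooted va) hw) dv v0)).
  by move=> x dx px _; rewrite dE dx parents_cons nroot // px.
- by apply: (array_same va) => x; rewrite vs0.
Qed.

Lemma hollow_links m arcs vp bads u : linked m arcs ->
  virtual_forest (dom m) (full m) (rk m) arcs vp bads None ->
  let m' := update u make_hollow m in
  linked m' arcs /\ exists bads',
    virtual_forest (dom m') (full m') (rk m') arcs vp bads' None /\
    size bads' <= rk m u + size bads.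
Proof.
move=> wl vf m'.
have fullE x : full m' x = (x != u) && full m x.
  rewrite get_update; case: eqP => // _.
  by rewrite /get; case: m.[? u].
split.
  apply: (wl_same wl) => x; rewrite ?fullE !get_update_id //.
  by case/andP => _; apply: (wl_full wl).
have [s sz sP] := virtual_children_seq vf u 0 (domE m).
exists (s ++ bads); split; last by rewrite size_cat; lia.
by apply: (vf_delete vf) fullE _ => // x; rewrite ?get_update_id // => vx xu; apply: sP.
Qed.

Lemma pays_delete m H A h w u e : H.[? h] = Some (Some w) ->
  holds m H h u e ->
  pays (State m H A Idle) (Some (Delete e u h))
    (State (update u make_hollow m) H.[~ h] A (Return (Some w))).
Proof.
move=> hw [uh _] p [arcs [vp [bads [vs [M [/= va pot]]]]]].
have [wl' [bads' [vf' sz]]] := hollow_links u (va_linked va) (va_forest va).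
rewrite /heap_nodes hw /= in uh.
have cf := dag_nodes_confined (Some w) (va_linked va).
have ru := confined_rank (va_forest va) cf (dag_nodesP uh).1 uh.
apply: (@invariantI _ _ _ _ arcs vp bads' vs M); last first.
  rewrite /= /num_nodes /heap_nodes /= hw /=; move: ru sz.
  by move: (trunc_log _ _) => N ru sz; lia.
split=> //.
- apply: rooted_dom (rooted_take (va_rooted va) hw) _ => x.
  by rewrite get_update_id.
- by apply: (array_same va) => v _; rewrite get_update_id.
- exact: (va_control va).
Qed.

(** [M] is chosen here for the whole operation, from the dag at invocation. An abstract [o] serves
    both delete-min and the deletion of the root's item. *)
Lemma pays_delete_root m H A h u o : H.[? h] = Some (Some u) ->
  amortized_time 20 27 (o, State m H A Idle) =
    27 * (trunc_log 2 (num_nodes (State m H A Idle) h)).+1 ->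
  pays (State m H A Idle) (Some o)
    (State (update u make_hollow m) H.[~ h] A (Choosing [:: u] [::])).
Proof.
move=> hu co p [arcs [vp [bads [vs [M [/= va pot]]]]]].
have [wl' [bads' [vf' sz]]] := hollow_links u (va_linked va) (va_forest va).
have [du u0 _] := rt_heap (va_rooted va) hu.
have uh := dag_nodes_root du.
have cf := dag_nodes_confined (Some u) (va_linked va).
have ru := confined_rank (va_forest va) cf du uh.
have vs0 : vs = [::] := va_control va.
apply: (@invariantI _ _ _ _ arcs vp bads' vs
  (trunc_log 2 #|` dag_nodes m (Some u)|).*2.+1); last first.
  rewrite -[X in _ < p + X]/(amortized_time 20 27 (o, State m H A Idle)) co.
  rewrite /num_nodes /heap_nodes /= hu /=; move: ru sz.
  by move: (trunc_log _ _) => N ru sz; lia.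
split=> //.
- apply: rooted_dom (rooted_take (va_rooted va) hu) _ => x.
  by rewrite get_update_id.
- by apply: (array_same va) => v _; rewrite get_update_id.
- split=> //.
  + by apply: confined_sub cf => // x; rewrite inE => /eqP ->.
  + move=> x; rewrite inE => /eqP ->; rewrite get_update eqxx /get.
    by case: m.[? u].
Qed.

Lemma pays_answer m H A (y : option E) :
  pays (State m H A (Answer y)) None (State m H A Idle).
Proof.
move=> p [arcs [vp [bads [vs [M [/= va pot]]]]]].
apply: (invariantI (valid_move (c' := Idle) va _ _ _ _)) => //=.
- exact: (va_array va).
- exact: (va_control va).
- lia.
Qed.

Lemma pays_return m H A r h : h \notin domf H ->
  pays (State m H A (Return r)) None (State m H.[h <- r] A Idle).
Proof.
move=> hH p [arcs [vp [bads [vs [M [/= va pot]]]]]].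
have vs0 : vs = [::] := va_control va.
apply: (@invariantI _ _ _ _ arcs vp bads vs M); last by rewrite /=; lia.
split=> //.
- exact: (va_linked va).
- exact: (va_forest va).
- have := va_rooted va; rewrite vs0 cats0 => rt.
  exact: rooted_put rt hH.
- exact: (va_array va).
Qed.

Lemma pays_meld_empty_l m H A r :
  pays (State m H A (Melding None r)) None (State m H A (Return r)).
Proof.
move=> p [arcs [vp [bads [vs [M [/= va pot]]]]]].
apply: (invariantI (valid_move (c' := Return r) (vs' := vs) va _ _ _ _)) => //=.
- exact: (va_array va).
- exact: (va_control va).
- lia.
Qed.

Lemma pays_meld_empty_r m H A r :
  pays (State m H A (Melding r None)) None (State m H A (Return r)).
Proof.
move=> p [arcs [vp [bads [vs [M [/= va pot]]]]]].
apply: (invariantI (valid_move (c' := Return r) (vs' := vs) va _ _ _ _)) => //=.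
- by rewrite cats0.
- exact: (va_array va).
- exact: (va_control va).
- lia.
Qed.

Lemma pays_meld_link m H A u v w m' : link m u v w m' ->
  pays (State m H A (Melding (Some u) (Some v))) None
    (State m' H A (Return (Some w))).
Proof.
move=> /link_dom[du dv [l [wl ->]]] p [arcs [vp [bads [vs [M [/= va pot]]]]]].
have uv : u != v.
  by have := rt_uniq (va_rooted va); rewrite /= inE negb_or => /andP[/andP[]].
apply: (@invariantI _ _ _ _ ((w, l) :: arcs) vp bads vs M); last first.
  by rewrite /=; lia.
apply: (valid_unranked_link va) => //=.
- by case: wl => -[-> _].
- by rewrite !inE; case: wl => -[_ ->]; rewrite eqxx ?orbT.
- by case: wl => -[-> ->]; rewrite ?eqxx // (negPf uv).
- exact: (va_control va).
Qed.

(** * Delete: destruction of hollow roots *)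

Lemma pays_choose m H A hs fs u : u \in hs ->
  pays (State m H A (Choosing hs fs)) None
    (State m H A (Destroying u (rem u hs) fs)).
Proof.
move=> uhs p [arcs [vp [bads [vs [M [/= va pot]]]]]].
have [vs0 cf hhs ffs] := va_control va.
have [du u0] : dom m u /\ parents arcs u = 0.
  by apply: (rt_live (va_rooted va)); rewrite /= !mem_cat uhs.
have [vp' vf'] := vf_start_destroy (va_forest va) erefl (hhs u uhs) u0.
apply: (@invariantI _ _ _ _ arcs vp' bads vs M); last by rewrite /=; lia.
split=> //.
- exact: (va_linked va).
- apply: rooted_perm (va_rooted va) _.
  by rewrite /= -!cat_cons !perm_cat2r perm_to_rem.
- exact: (va_array va).
- split=> //.
  + apply: confined_sub cf => // x; rewrite inE !mem_cat.
    case/or3P => [/eqP ->|/mem_rem ->|->] //.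
      by rewrite uhs.
    by rewrite orbT.
  + by move=> x; rewrite inE => /orP[/eqP ->|/mem_rem]; apply: hhs.
Qed.

Lemma destroying_root m H A u hs fs arcs vp bads vs M :
  valid m H A (Destroying u hs fs) arcs vp bads vs M ->
  dom m u /\ parents arcs u = 0.
Proof. by move=> va; apply: (rt_live (va_rooted va)); rewrite mem_head. Qed.

(** Of the two bounds on [cap], the upper one keeps full nodes at one parent at most, and the lower
    one allows a loss only at [w], where an arc disappears. *)
Lemma cut_links m m' H A u hs fs arcs vp bads vs M w cs :
  valid m H A (Destroying u hs fs) arcs vp bads vs M ->
  kids m u = w :: cs ->
  (forall x, kids m' x = if x == u then cs else kids m x) ->
  rk m' =1 rk m -> full m' =1 full m -> dom m' =1 dom m ->
  (forall x, cap m' x <= cap m x) ->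
  (forall x, cap m x <= cap m' x + (w == x)) ->
  let arcs' := rem (u, w) arcs in
  [/\ (u, w) \in arcs, linked m' arcs',
      virtual_forest (dom m') (full m') (rk m') arcs' vp bads (Some u) &
      rooted (dom m') arcs' H (loose_roots (Destroying u hs fs) ++ vs)].
Proof.
move=> va ku kE rE fE dE cle cge arcs'.
have [du u0] := destroying_root va.
have uw : (u, w) \in arcs by rewrite (mem_arcs (va_linked va)) ku mem_head.
split=> //.
- apply: (wl_remove_arc (va_linked va) _ ku) => // x.
  by rewrite fE => /(wl_full (va_linked va)); apply: leq_trans.
- apply: (vf_same (va_forest va)) => // x y /= ux.
  by apply: reach_rem => //; apply: contra_neq ux => ->.
- apply: (rooted_change (va_rooted va)) => x dx px _.
  by rewrite dE dx parents_rem // px.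
Qed.

Lemma pays_destroy_second_parent m H A u hs fs n w cs n1 :
  m.[? u] = Some n -> children n = w :: cs -> m.[? w] = Some n1 ->
  two_parents n1 ->
  pays (State m H A (Destroying u hs fs)) None
    (State (update w (set_two_parents false) (update u (set_children cs) m))
       H A (Destroying u hs fs)).
Proof.
move=> mu un mw wb p [arcs [vp [bads [vs [M [/= va pot]]]]]].
have [vs0 cf hhs ffs] := va_control va.
set m' := update w _ _.
have capE x : cap m' x = if x == w then 1 else cap m x.
  rewrite get_update !get_update_id //.
  by rewrite (get_some _ _ mw).
have fE : full m' =1 full m by move=> x; rewrite !get_update_id.
have rE : rk m' =1 rk m by move=> x; rewrite !get_update_id.
have [|||||uw wl' vf' rt'] := cut_links (m' := m') (w := w) (cs := cs) va _ _ rE fE.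
- by rewrite (get_some _ _ mu).
- move=> x; rewrite get_update_id // get_update.
  by case: eqP => // _; rewrite (get_some _ _ mu).
- by move=> x; rewrite !get_update_id.
- by move=> x; rewrite capE; case: eqP => // ->; rewrite (get_some _ _ mw).
- move=> x; rewrite capE eq_sym; case: eqP => [<-|_]; last by rewrite addn0.
  by rewrite (get_some _ _ mw) wb.
apply: (@invariantI _ _ _ _ (rem (u, w) arcs) vp bads vs M); last first.
  by rewrite /= size_rem //; case: (arcs) uw pot => //= *; lia.
split=> //.
- exact: array_same va _.
- split=> // [|x xu|x xfs]; [|by rewrite fE; apply: hhs|by rewrite fE; apply: ffs].
  by apply: confined_sub cf => // x /mem_rem.
Qed.

Lemma pays_destroy_last_parent m H A u hs fs n w cs n1 :
  m.[? u] = Some n -> children n = w :: cs -> m.[? w] = Some n1 ->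
  ~~ two_parents n1 ->
  pays (State m H A (Destroying u hs fs)) None
    (State (update u (set_children cs) m) H A
       (if hollow n1 then Destroying u (w :: hs) fs
        else Destroying u hs (w :: fs))).
Proof.
move=> mu un mw wb p [arcs [vp [bads [vs [M [/= va pot]]]]]].
have [vs0 cf hhs ffs] := va_control va.
set m' := update u _ _; set c' := (if _ then _ else _).
have fE : full m' =1 full m by move=> x; rewrite !get_update_id.
have rE : rk m' =1 rk m by move=> x; rewrite !get_update_id.
have dE : dom m' =1 dom m by move=> x; rewrite !get_update_id.
have [||||uw wl' vf' rt'] := cut_links (m' := m') (w := w) (cs := cs) va _ _ rE fE dE.
- by rewrite (get_some _ _ mu).
- move=> x; rewrite get_update.
  by case: eqP => // _; rewrite (get_some _ _ mu).
- by move=> x; rewrite get_update_id.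
- by move=> x; rewrite get_update_id // leq_addr.
have dw : dom m w by rewrite /get mw.
(* The arc from [u] gives at least one parent and the unset bit at most one, so the cut makes [w] a
   root. *)
have w1 : parents arcs w = 1.
  have := wl_parents (va_linked va) w; have := parents_gt0 uw.
  by rewrite (get_some _ _ mw) (negPf wb); case: parents => [|[]].
have w0 : parents (rem (u, w) arcs) w = 0 by rewrite parents_rem // w1 eqxx.
have rtw : rooted (dom m') (rem (u, w) arcs) H
    (w :: loose_roots (Destroying u hs fs) ++ vs).
  apply: rooted_cons rt' _ w0 _ _; first by rewrite dE.
    by apply/negP => /(rt_live (va_rooted va))[_]; rewrite w1.
  by move=> h /(rt_heap (va_rooted va))[_]; rewrite w1.
have cE : perm_eq (w :: loose_roots (Destroying u hs fs)) (loose_roots c').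
  by rewrite /c'; case: hollow; apply/seq.permP => q; rewrite /= !count_cat /=; lia.
apply: (@invariantI _ _ _ _ (rem (u, w) arcs) vp bads vs M); last first.
  have -> : control_potential c' vs M = (6 * M + 14)%N by rewrite /c'; case: ifP.
  by rewrite size_rem //; case: (arcs) uw pot => //= *; lia.
split=> //.
- by have -> : destroyed c' = Some u by rewrite /c'; case: ifP.
- by apply: rooted_perm rtw _; rewrite -cat_cons perm_cat2r.
- exact: array_same va _.
have cf' : confined (rem (u, w) arcs) (loose_roots c') M.
  have := confined_arc uw (mem_head u _) cf; apply: confined_sub => [x /mem_rem //|x].
  by rewrite -(perm_mem cE).
have fw : full m w = ~~ hollow n1 by rewrite (get_some _ _ mw) negbK.
move: cf'; rewrite /c'; case: ifPn fw => hw fw cf'; split=> // x.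
- rewrite !inE fE orbCA => /orP[/eqP ->|xu]; first by rewrite fw.
  by apply: hhs; rewrite inE.
- by rewrite fE; apply: ffs.
- by rewrite fE; apply: hhs.
- by rewrite inE fE => /orP[/eqP ->|/ffs//]; rewrite fw.
Qed.

Lemma pays_destroy_end m H A u hs fs n :
  m.[? u] = Some n -> children n = [::] ->
  pays (State m H A (Destroying u hs fs)) None
    (State m.[~ u] H A (Choosing hs fs)).
Proof.
move=> mu un p [arcs [vp [bads [vs [M [/= va pot]]]]]].
have [vs0 cf hhs ffs] := va_control va.
have [du u0] := destroying_root va.
(* The 5 units released here cover this transition and the choice of the next hollow root. *)
have ub : u \in bads := parentless_bad (va_forest va) du u0.
have out x : x \in hs ++ fs -> (x == u) = false.
  move=> xL; apply: contraTF (rt_uniq (va_rooted va)) => /eqP xu.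
  by rewrite /= mem_cat -xu xL.
apply: (@invariantI _ _ _ _ arcs vp (rem u bads) vs M); last first.
  by rewrite /= size_rem //; case: (bads) ub pot => //= *; lia.
split=> //.
- have ku : kids m u = [::] by rewrite (get_some _ _ mu).
  apply: (wl_remove (va_linked va) _ ku u0) => x.
  + by rewrite !get_rem; case: eqP => // _; apply: (wl_full (va_linked va)).
  + by rewrite get_rem.
  + by move=> xu; rewrite get_rem (negPf xu).
- apply: (vf_end_destroy (va_forest va) erefl u0) => x; rewrite get_rem.
  + by case: eqP.
  + by move/negPf ->.
  + by move/negPf ->.
- by apply: (rooted_behead (va_rooted va)) => x; rewrite get_rem; case: eqP.
- by apply: (array_same va) => x; rewrite vs0.
- split=> // [|x xh|x xf].
  + by apply: confined_sub cf => // x; rewrite inE orbC => ->.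
  + by rewrite get_rem out ?mem_cat ?xh // hhs // inE xh orbT.
  + by rewrite get_rem out ?mem_cat ?xf ?orbT // ffs.
Qed.

(** * Delete: ranked links through the array *)

Lemma pays_choose_end m H A fs :
  pays (State m H A (Choosing [::] fs)) None (State m H A (Placing fs 0)).
Proof.
move=> p [arcs [vp [bads [vs [M [/= va pot]]]]]].
have [vs0 cf _ ffs] := va_control va.
apply: (invariantI (valid_move (c' := Placing fs 0) va _ _ _ _)) => //=.
- exact: (va_array va).
- by rewrite vs0 cats0; split.
- rewrite vs0 /=; lia.
Qed.

Lemma pays_place m H A fs b u : u \in fs ->
  pays (State m H A (Placing fs b)) None (State m H A (Ranking u (rem u fs) b)).
Proof.
move=> ufs p [arcs [vp [bads [vs [M [/= va pot]]]]]].
have [cf ffs bM vb] := va_control va.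
have pE : perm_eq (fs ++ vs) (u :: rem u fs ++ vs).
  by rewrite -cat_cons perm_cat2r perm_to_rem.
apply: (invariantI (valid_move (c' := Ranking u (rem u fs) b) va _ pE _ _)) => //=.
- exact: (va_array va).
- split=> // [|v]; last by rewrite -(perm_mem pE); apply: ffs.
  by apply: confined_sub cf => // v; rewrite (perm_mem pE).
- lia.
Qed.

(** The bound comes from tree size in the fixed closed set, so it holds after any number of ranked
    links. *)
Lemma ranking_rank m H A u fs b arcs vp bads vs M :
  valid m H A (Ranking u fs b) arcs vp bads vs M -> rk m u <= M.
Proof.
move=> va; have [cf ffs _ _] := va_control va.
exact: (confined_rank (va_forest va) cf (full_dom (ffs u (mem_head _ _))) (mem_head _ _)).
Qed.

Lemma pays_store m H A u fs b n :
  m.[? u] = Some n -> A.[? rank n] = None ->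
  pays (State m H A (Ranking u fs b)) None
    (State m H A.[rank n <- u] (Placing fs (maxn b (rank n)))).
Proof.
move=> mu An p [arcs [vp [bads [vs [M [/= va pot]]]]]].
have [cf ffs bM vb] := va_control va.
have ru : rk m u = rank n by rewrite (get_some _ _ mu).
have uM := ranking_rank va.
(* Hence the truncated [M.+2 - size vs] is positive and really drops when [u] is stored. *)
have sz : size vs <= M.+1.
  by apply: (array_size va) => v /vb vb'; apply: leq_trans vb' bM.
have pE : perm_eq (u :: fs ++ vs) (fs ++ u :: vs).
  by rewrite perm_sym -cat_rcons -cat_cons perm_cat2r perm_rcons.
apply: (invariantI (valid_move (c' := Placing fs (maxn b (rank n))) va _ pE _ _)) => //=.
- move=> i v; rewrite fnd_set inE; have [->|ne] := eqVneq i (rank n).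
    split=> [[<-]|]; first by rewrite eqxx.
    case=> /orP[/eqP -> //|vvs rv].
    by have := iffRL (va_array va _ _) (conj vvs rv); rewrite An.
  rewrite (va_array va); split=> [[-> ->]|[]]; first by rewrite orbT.
  case/orP => [/eqP ->|//]; by rewrite ru => e; rewrite e eqxx in ne.
- split.
  + by apply: confined_sub cf => // x; rewrite (perm_mem pE).
  + by move=> x; rewrite -(perm_mem pE); apply: ffs.
  + by rewrite geq_max bM -ru.
  + by move=> v; rewrite inE leq_max => /orP[/eqP ->|/vb ->//]; rewrite ru leqnn orbT.
- lia.
Qed.

Lemma pays_ranked_link m H A u fs b n v w m' :
  m.[? u] = Some n -> A.[? rank n] = Some v -> link m u v w m' ->
  pays (State m H A (Ranking u fs b)) None
    (State (update w incr_rank m') H A.[~ rank n] (Ranking w fs b)).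
Proof.
(* The net change is 1 for the arc, minus 5 for the loser, plus 3 for the emptied entry. Positivity
   of [b'] and [c] makes both predecessors genuine. *)
have arith (a b' c M p : nat) : 0 < b' -> 0 < c -> c <= M.+1 ->
    a + 5 * b' + (3 * (M.+2 - c) + 3 * M + 6) <= p ->
    a.+1 + 5 * b'.-1 + (3 * (M.+2 - c.-1) + 3 * M + 6) < p + 0 by lia.
move=> mu An /link_dom[du dv [l [wl ->]]] p [arcs [vp [bads [vs [M [/= va pot]]]]]].
have [cf ffs bM vb] := va_control va.
have ru : rk m u = rank n by rewrite (get_some _ _ mu).
have [vvs rv] := iffLR (va_array va _ _) An.
set L := u :: fs ++ vs in cf ffs; have uL : u \in L := mem_head _ _.
have vL : v \in L by rewrite inE mem_cat vvs !orbT.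
have uniqL : uniq L := rt_uniq (va_rooted va).
have uv : u != v.
  move: uniqL => /= /andP[]; rewrite mem_cat negb_or => /andP[_ uvs] _.
  by apply: contraNneq uvs => ->.
have wL : w \in L by case: wl => -[-> _].
have lL : l \in L by case: wl => -[_ ->].
have wl_ne : w != l by case: wl => -[-> ->] //; rewrite eq_sym.
have [dw w0] := rt_live (va_rooted va) wL; have [dl l0] := rt_live (va_rooted va) lL.
have rwl : rk m w = rk m l by case: wl => -[-> ->]; rewrite ru rv.
have pE : perm_eq (rem l L) (w :: fs ++ rem v vs).
  have: perm_eq (l :: rem l L) (l :: w :: fs ++ rem v vs).
    rewrite -(permPl (perm_to_rem lL)).
    have pv : perm_eq L (u :: v :: fs ++ rem v vs).
      rewrite perm_cons; have := perm_to_rem vvs; rewrite -(perm_cat2l fs).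
      by move/perm_trans; apply; rewrite perm_catC /= perm_cons perm_catC.
    by case: wl => -[-> ->] //; rewrite (permPl pv) (perm_catCA [:: u] [:: v]).
  by rewrite perm_cons.
set m1 := update w incr_rank _.
have rkE x : rk m1 x = (rk m x + (x == w))%N.
  rewrite get_update; case: eqP => [->|_]; rewrite ?get_update_id ?addn0 //.
  have [k mk] := dom_get dw.
  by rewrite !(get_some _ _ mk) /= addn1.
have fE : full m1 =1 full m by move=> x; rewrite !get_update_id.
have dE : dom m1 =1 dom m by move=> x; rewrite !get_update_id.
have wv x : x \in rem v vs -> (x == w) = false.
  move=> xv; have: uniq (w :: fs ++ rem v vs) by rewrite -(perm_uniq pE) rem_uniq.
  rewrite /= mem_cat => /andP[]; rewrite negb_or => /andP[_ nw] _.
  by apply: contraNF nw => /eqP <-.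
have [vp' vf'] := vf_link (va_forest va) erefl dw dl wl_ne w0 l0 rwl (ffs w wL) dE fE rkE.
have lb : l \in bads := parentless_bad (va_forest va) dl l0.
have sz : size vs <= M.+1.
  by apply: (array_size va) => x /vb xb; apply: leq_trans xb bM.
apply: (@invariantI _ _ _ _ ((w, l) :: arcs) vp' (rem l bads) (rem v vs) M); last first.
  rewrite /= !size_rem //; apply: arith pot => //; first by case: (bads) lb.
  by case: (vs) vvs.
split=> //.
- apply: (wl_same (linked_link (va_linked va) dw dl l0)) => x.
  + by rewrite fE !get_update_id //; apply: (wl_full (va_linked va)).
  + by rewrite get_update_id.
  + by rewrite !get_update_id.
- have rt := rooted_perm (rooted_link w (va_rooted va) lL) pE.
  by apply: (rooted_dom rt) => x; rewrite dE.
- move=> i x; rewrite (array_rem va An) rkE; split=> -[xv]; by rewrite wv // addn0.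
- split=> //.
  + apply: confined_sub (confined_link w lL cf) => // x.
    by rewrite -(perm_mem pE) => /mem_rem.
  + by move=> x; rewrite -(perm_mem pE) fE => /mem_rem; apply: ffs.
  + by move=> x xv; rewrite rkE wv // addn0 vb // (mem_rem xv).
Qed.

(** * Delete: scan of the array and unranked links *)

Lemma pays_place_end m H A b :
  pays (State m H A (Placing [::] b)) None (State m H A (Scanning 0 b [::])).
Proof.
move=> p [arcs [vp [bads [vs [M [/= va pot]]]]]].
have [cf ffs bM vb] := va_control va.
apply: (invariantI (valid_move (c' := Scanning 0 b [::]) va _ _ _ _)) => //=.
- exact: (va_array va).
- lia.
Qed.

Lemma pays_scan_none m H A i b rs : i <= b -> A.[? i] = None ->
  pays (State m H A (Scanning i b rs)) None (State m H A (Scanning i.+1 b rs)).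
Proof.
move=> ib Ai p [arcs [vp [bads [vs [M [/= va pot]]]]]].
have [bM vb] := va_control va.
apply: (invariantI (valid_move (c' := Scanning i.+1 b rs) va _ _ _ _)) => //=.
- exact: (va_array va).
- split=> // v vvs; have /andP[iv ->] := vb v vvs; rewrite andbT ltn_neqAle iv andbT.
  apply/eqP => e; have := iffRL (va_array va _ _) (conj vvs (esym e)).
  by rewrite Ai.
- lia.
Qed.

Lemma pays_scan_some m H A i b rs u : i <= b -> A.[? i] = Some u ->
  pays (State m H A (Scanning i b rs)) None
    (State m H A.[~ i] (Scanning i.+1 b (u :: rs))).
Proof.
move=> ib Ai p [arcs [vp [bads [vs [M [/= va pot]]]]]].
have [bM vb] := va_control va.
have [uvs ru] := iffLR (va_array va _ _) Ai.
have AE := array_rem va Ai.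
apply: (invariantI (valid_move (c' := Scanning i.+1 b (u :: rs)) va _ _ AE _)) => //=.
- have := perm_to_rem uvs; rewrite -(perm_cat2l rs) => /perm_trans; apply.
  by rewrite -cat_cons -cat_rcons perm_cat2r perm_rcons.
- split=> // v vr; have vvs := mem_rem vr.
  have /andP[iv ->] := vb v vvs; rewrite andbT ltn_neqAle iv andbT.
  apply/eqP => e; have := iffRL (AE i v) (conj vr (esym e)).
  by rewrite fnd_rem1 eqxx.
- lia.
Qed.

Lemma pays_scan_end m H A i b rs : b < i ->
  pays (State m H A (Scanning i b rs)) None (State m H A (Uniting rs)).
Proof.
move=> ib p [arcs [vp [bads [vs [M [/= va pot]]]]]].
have [bM vb] := va_control va.
have vs0 : vs = [::].
  case: (vs) vb => // v vs' /(_ v (mem_head _ _)) /andP[iv vb].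
  by move: ib; rewrite ltnNge (leq_trans iv vb).
apply: (invariantI (valid_move (c' := Uniting rs) va _ (perm_refl _) _ _)) => //=.
- exact: (va_array va).
- lia.
Qed.

Lemma pays_unranked_link m H A rs w l : w \in rs -> l \in rem w rs ->
  pays (State m H A (Uniting rs)) None
    (State (add_child w l m) H A (Uniting (rem l rs))).
Proof.
move=> wrs lrs p [arcs [vp [bads [vs [M [/= va pot]]]]]].
have lrs' := mem_rem lrs.
have [dw _] : dom m w /\ parents arcs w = 0.
  by apply: (rt_live (va_rooted va)); rewrite /= mem_cat wrs.
apply: (@invariantI _ _ _ _ ((w, l) :: arcs) vp bads vs M); last first.
  by rewrite /= size_rem //; case: (rs) lrs' pot => //= *; lia.
apply: (valid_unranked_link va) => //=.
exact: (va_control va).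
Qed.

Lemma pays_unite_end m H A r :
  pays (State m H A (Uniting (olist r))) None (State m H A (Return r)).
Proof.
move=> p [arcs [vp [bads [vs [M [/= va pot]]]]]].
apply: (invariantI (valid_move (c' := Return r) va _ (perm_refl _) _ _)) => //=.
- exact: (va_array va).
- exact: (va_control va).
- lia.
Qed.

(** * Summation over an execution *)

Lemma step_pays s o s' : step s o s' -> pays s o s'.
Proof.
case=> {s o s'} *.
- exact: pays_make_heap.
- exact: pays_find_min.
- exact: pays_insert.
- exact: pays_meld.
- exact: pays_decrease_key_root.
- exact: pays_decrease_key_new_root.
- exact: pays_decrease_key.
- exact: pays_delete.
- exact: pays_delete_root.
- exact: pays_delete_root.
- exact: pays_answer.
- exact: pays_return.
- exact: pays_meld_empty_l.
- exact: pays_meld_empty_r.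
- exact: pays_meld_link.
- exact: pays_choose.
- apply: pays_destroy_second_parent; eassumption.
- apply: pays_destroy_last_parent; eassumption.
- apply: pays_destroy_end; eassumption.
- exact: pays_choose_end.
- exact: pays_place.
- apply: pays_store; eassumption.
- apply: pays_ranked_link; eassumption.
- exact: pays_place_end.
- exact: pays_scan_none.
- exact: pays_scan_some.
- exact: pays_scan_end.
- exact: pays_unranked_link.
- exact: (@pays_unite_end _ _ _ (Some _)).
- exact: (@pays_unite_end _ _ _ None).
Qed.

Lemma initial_invariant : invariant initial_state 0.
Proof.
exists [::], id, [::], [::], 0; split=> //; split=> //=.
- by split=> [u v|v|v]; rewrite /get fnd_fmap0.
- by split=> [w|w|w|w w'|x i|w|x]; rewrite ?eqxx // /get fnd_fmap0.
- by split=> // [h u|h h' u]; rewrite fnd_fmap0.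
- by move=> i v; rewrite fnd_fmap0; split=> // -[].
Qed.

(** Keeping the current potential beside [t] lets the step bounds telescope from the initial
    potential 0. *)
Lemma execution_invariant t tr s : execution t tr s ->
  exists2 p, invariant s p & t + p <= \sum_(i <- tr) amortized_time 20 27 i.
Proof.
elim=> {t tr s} [|t tr s o s' _ [p ip le] st|t tr s s' _ [p ip le] st].
- by exists 0; [exact: initial_invariant|rewrite big_nil].
- have [p' ip' lt] := step_pays st ip; exists p' => //.
  by rewrite -cats1 big_cat big_seq1 /=; rewrite /= in lt; lia.
- have [p' ip' lt] := step_pays st ip; exists p' => //.
  by rewrite /= in lt; lia.
Qed.

End Memory.

Theorem theorem4p8 :
  exists c d : nat,
  forall (disp : Order.disp_t) (K : orderType disp) (E : Type)
         (t : nat) (tr : seq (operation K E * state K E)) (s : state K E),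
    execution t tr s ->
    t <= \sum_(i <- tr) amortized_time c d i.
Proof.
exists 20, 27 => disp K E t tr s /execution_invariant[p _].
exact: leq_trans (leq_addr _ _).
Qed.
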